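(* Let $\mathcal{E}$ be an exponential family of dimension $n$ defined over a finite set $\Omega=\{x_1,\dots,x_m\}$, and let $\Phi:\mathbb{T}^n\times N\to N$ be a Kähler toric manifold with Kähler metric $g$ which is a regular torification of $\mathcal{E}$. Suppose that the estimator map $F:\Omega\to\mathbb{R}^n$ is injective. If $f$ is a Kähler function on $N$, then $$\mathrm{Crit}(f)\subseteq\mathrm{spec}(f),$$ where $\mathrm{Crit}(f)$ is the set of critical values of $f$, i.e. the set of $\lambda\in\mathbb{R}$ for which there is $p\in N$ with $f(p)=\lambda$ and $df_p=0$, and $\mathrm{spec}(f)$ is the spectrum of $f$.
   Context: Kähler toric manifolds. $\mathbb{T}^n=\mathbb{R}^n/\mathbb{Z}^n$; its Lie algebra is identified with $\mathbb{R}^n$ via the derivative at $0$ of the quotient map, and $\mathbb{R}^n$ with its dual via the Euclidean product $\langle\,,\,\rangle$. For an action $\Phi:\mathbb{T}^n\times N\to N$ write $\Phi_a(p)=\Phi(a,p)$ and $\xi_N(p)=\frac{d}{dt}\big|_0\Phi([t\xi],p)$ for $\xi\in\mathbb{R}^n$. A Kähler toric manifold is a connected compact Kähler manifold $N$ of complex dimension $n$ (metric $g$, complex structure $I$, Kähler form $\omega=g(I\cdot,\cdot)$) with an effective action $\Phi$ of $\mathbb{T}^n$ by holomorphic isometries and a momentum map $\mathbf{J}:N\to\mathbb{R}^n$, i.e. a smooth $\mathbb{T}^n$-invariant map with $\omega(\xi_N,\cdot)=d\mathbf{J}^\xi$ for all $\xi$, where $\mathbf{J}^\xi(p)=\langle\mathbf{J}(p),\xi\rangle$.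 $N^\circ$ is the (open, dense, connected) set of points where $\Phi$ is free. Exponential family. $\Omega$ carries the counting measure. $\mathcal{E}$ is the set of probability functions $p_\theta(x)=\exp\big(C(x)+\sum_{k=1}^n\theta_kF_k(x)-\psi(\theta)\big)$, $\theta\in\mathbb{R}^n$, where $C,F_1,\dots,F_n:\Omega\to\mathbb{R}$, $\psi:\mathbb{R}^n\to\mathbb{R}$, and $1,F_1,\dots,F_n$ are linearly independent; $\theta$ is a global chart of $\mathcal{E}$. $\mathbb{E}_p(X)=\sum_{x\in\Omega}X(x)p(x)$. $\mathcal{E}$ carries the Fisher metric $(h_F)_{ij}(\theta)=\mathbb{E}_{p_\theta}(\partial_i\ln p_\theta\,\partial_j\ln p_\theta)$ and the exponential connection $\nabla^{(e)}$, the flat connection for which $\theta_1,\dots,\theta_n$ are affine coordinates. The estimator map is $F=(F_1,\dots,F_n):\Omega\to\mathbb{R}^n$, and $\mathcal{A}_{\mathcal{E}}$ is the real vector space of functions on $\Omega$ spanned by $F_1,\dots,F_n,1$. Torification. With coordinates $(\theta,\dot\theta)$ on $T\mathcal{E}$ (for the tangent vector $\sum_k\dot\theta_k\partial/\partial\theta_k$ at $p_\theta$), $T\mathcal{E}$ is a Kähler manifold with holomorphic coordinates $z_k=\theta_k+i\dot\theta_k$ and metric given by the block-diagonal matrix $\mathrm{diag}(h_F(\theta),h_F(\theta))$. A parallel lattice $L\subset T\mathcal{E}$ is the set of all integer combinations $\sum k_iY_i(p)$, $p\in\mathcal{E}$, of a frame $Y=(Y_1,\dots,Y_n)$ of $\nabla^{(e)}$-parallel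 vector fields on $\mathcal{E}$ (a generator of $L$). $\Gamma(L)\cong\mathbb{Z}^n$ is the group of maps $u\mapsto u+\sum k_iY_i$ of $T\mathcal{E}$; $\mathcal{E}_L=T\mathcal{E}/\Gamma(L)$ with its induced Kähler structure, $q_L:T\mathcal{E}\to\mathcal{E}_L$ is the quotient map, $\pi_L:\mathcal{E}_L\to\mathcal{E}$ the induced projection, and $\mathbb{T}^n$ acts on $\mathcal{E}_L$ by $\Phi_Y([t],q_L(u))=q_L(u+\sum t_iY_i)$. $(N,\Phi)$ is a torification of $\mathcal{E}$ if there are a parallel lattice $L$, a generator $Y$ and a holomorphic isometric diffeomorphism $G:\mathcal{E}_L\to N^\circ$ with $G\circ(\Phi_Y)_a=\Phi_a\circ G$ for all $a\in\mathbb{T}^n$. It is regular if $N$ is connected, simply connected, complete and has real-analytic Kähler metric. A compatible projection is a map $\kappa=\pi_L\circ G^{-1}:N^\circ\to\mathcal{E}$ for some such triple $(L,Y,G)$. Natural extension. $\mathcal{P}_m$ is the set of all probability functions on $\Omega$, with the topology of pointwise convergence, and $\overline{\mathcal{E}}$ is the closure of $\mathcal{E}$ in $\mathcal{P}_m$. Each compatible projection $\kappa$ has a unique continuous extension $K:N\to\overline{\mathcal{E}}$, called its natural extension. Kähler functions and spectrum. A smooth $f:N\to\mathbb{R}$ is Kähler if its Hamiltonian vector field $X_f$ (defined by $\omega(X_f,\cdot)=df$) is Killing. $\mathrm{Aut}(N,g)^0$ is the identity component of the group of holomorphic isometries of $N$ (compact-open topology). Every Kähler function can be written as $f(p)=\mathbb{E}_{K(\phi(p))}(X)$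 for all $p\in N$, with $X\in\mathcal{A}_{\mathcal{E}}$, $\phi\in\mathrm{Aut}(N,g)^0$ and $K$ the natural extension of a compatible projection; when $F$ is injective, the image of $X$ does not depend on the choice of $K,\phi,X$, and $\mathrm{spec}(f):=\{X(x_1),\dots,X(x_m)\}$. *)

(* Defs.v *)
From HB Require Import structures.
From mathcomp Require Import all_boot all_order all_algebra generic_quotient.
From mathcomp Require Import all_classical all_reals all_analysis.

Set Implicit Arguments.
Unset Strict Implicit.
Unset Printing Implicit Defensive.

Import Order.TTheory GRing.Theory Num.Theory numFieldNormedType.Exports.
Local Open Scope classical_set_scope.
Local Open Scope ring_scope.
Local Open Scope quotient_scope.

Section Calculus.
Variable R : realType.

(* In finite dimension this is the usual class C^k on an open set U. *)
Fixpoint Ck (V W : normedModType R) (k : nat) (U : set V) (f : V -> W) : Prop :=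
  if k is k'.+1 then
    (forall x, U x -> differentiable f x) /\
    (forall v, Ck k' U (fun x => 'D_v f x))
  else forall x, U x -> {for x, continuous f}.

Definition smooth_on (V W : normedModType R) (U : set V) (f : V -> W) : Prop :=
  forall k, Ck k U f.

Definition smooth_at (V W : normedModType R) (x : V) (f : V -> W) : Prop :=
  exists2 U, open_nbhs x U & smooth_on U f.

(* The multi-indices of degree k are the m : {ffun 'I_d -> 'I_k.+1} with
   \sum_i m i = k. *)
Definition analytic_at (d : nat) (f : 'rV[R]_d -> R) (x : 'rV[R]_d) : Prop :=
  exists (r : R) (a : ('I_d -> nat) -> R),
    [/\ 0 < r,
        cvgn (series (fun k : nat =>
          (\sum_(m : {ffun 'I_d -> 'I_k.+1} | (\sum_i m i)%N == k)
             `|a (fun i => m i)|) * r ^+ k))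
      & forall h : 'rV[R]_d, `|h| < r ->
          series (fun k : nat =>
            \sum_(m : {ffun 'I_d -> 'I_k.+1} | (\sum_i m i)%N == k)
               a (fun i => m i) * \prod_i h 0 i ^+ m i) @ \oo --> f (x + h)].

End Calculus.

Section Manifolds.
Variable R : realType.

(* [param i] is only meaningful on the image of [coord i], where it is the
   inverse chart; the axioms are in [is_manifold]. *)
Record atlas (V : normedModType R) (M : topologicalType) := Atlas {
  chart : Type;
  dom : chart -> set M;
  coord : chart -> M -> V;
  param : chart -> V -> M }.

Definition coord_range (V : normedModType R) (M : topologicalType)
  (A : atlas V M) (i : chart A) : set V := coord i @` dom i.

Definition vector_atlas (V : normedModType R) : atlas V V :=
  @Atlas V V unit (fun=> setT) (fun=> id) (fun=> id).

Definition product_atlas (V W : normedModType R) (M M' : topologicalType)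
    (A : atlas V M) (B : atlas W M') : atlas (V * W)%type (M * M')%type :=
  @Atlas (V * W)%type (M * M')%type (chart A * chart B)%type
    (fun ij => dom ij.1 `*` dom ij.2)
    (fun ij p => (coord ij.1 p.1, coord ij.2 p.2))
    (fun ij x => (param ij.1 x.1, param ij.2 x.2)).

Definition is_manifold (V : normedModType R) (M : topologicalType)
    (A : atlas V M) : Prop :=
  [/\ hausdorff_space M, @second_countable M,
      forall p, exists i : chart A, dom i p,
      forall i : chart A,
        [/\ open (dom i), open (coord_range i),
            forall p, dom i p -> param i (coord i p) = p,
            forall p, dom i p -> {for p, continuous (coord i)}
          & forall x, coord_range i x -> {for x, continuous (param i)}]
    & forall i j : chart A,
        smooth_on (coord i @` (dom i `&` dom j)) (coord j \o param i)].

Definition smooth_map (V W : normedModType R) (M M' : topologicalType)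
    (A : atlas V M) (B : atlas W M') (D : set M) (F : M -> M') : Prop :=
  forall p, D p -> {for p, continuous F} /\
    forall (i : chart A) (j : chart B), dom i p -> dom j (F p) ->
      smooth_at (coord i p) (coord j \o F \o param i).

(* The differential of F at p, read in the charts i (source) and j (target). *)
Definition tangent_map (V W : normedModType R) (M M' : topologicalType)
    (A : atlas V M) (B : atlas W M') (F : M -> M')
    (i : chart A) (j : chart B) (p : M) : V -> W :=
  'd (coord j \o F \o param i) (coord i p).

Definition simply_connected (M : topologicalType) : Prop :=
  (forall p q : M, exists2 gam : R -> M,
      {within `[0, 1], continuous gam} & gam 0 = p /\ gam 1 = q) /\
  (forall gam : R -> M, {within `[0, 1], continuous gam} -> gam 0 = gam 1 ->
    exists2 H : R * R -> M,
      {within `[0, 1] `*` `[0, 1], continuous H} &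
      (forall t, t \in `[0, 1] -> H (t, 0) = gam t /\ H (t, 1) = gam 0) /\
      (forall s, s \in `[0, 1] -> H (0, s) = gam 0 /\ H (1, s) = gam 0)).

End Manifolds.

Section Kahler.
Variables (R : realType) (n : nat).

(* C^n is R^(n + n) through x + i y |-> (x, y); multiplication by the
   imaginary unit is (x, y) |-> (- y, x). *)
Definition cplx (v : 'rV[R]_(n + n)) : 'rV[R]_(n + n) :=
  v *m block_mx 0 1%:M (- 1%:M) 0.

Definition inner (d : nat) (A : 'M[R]_d) (u v : 'rV[R]_d) : R :=
  (u *m A *m v^T) 0 0.

(* Raw data: an atlas and the Gram matrices of the metric in each chart. *)
Record kahlerData := KahlerData {
  kspace :> topologicalType;
  katlas : atlas 'rV[R]_(n + n) kspace;
  kmetric : chart katlas -> 'rV[R]_(n + n) -> 'M[R]_(n + n) }.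

Definition kform (M : kahlerData) (i : chart (katlas M)) (x u v : 'rV[R]_(n + n))
  : R := inner (kmetric i x) (cplx u) v.

Definition is_complex_manifold (M : kahlerData) : Prop :=
  is_manifold (katlas M) /\
  forall (i j : chart (katlas M)) (p : M), dom i p -> dom j p -> forall v,
    tangent_map (A := katlas M) (B := katlas M) id i j p (cplx v) =
    cplx (tangent_map (A := katlas M) (B := katlas M) id i j p v).

Definition is_riemannian (M : kahlerData) : Prop :=
  (forall i : chart (katlas M),
    smooth_on (coord_range i) (kmetric i) /\
    forall x, coord_range i x ->
      (kmetric i x)^T = kmetric i x /\
      forall v, v != 0 -> 0 < inner (kmetric i x) v v) /\
  (forall (i j : chart (katlas M)) (p : M), dom i p -> dom j p -> forall u v,
    let T := tangent_map (A := katlas M) (B := katlas M) id i j p in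
    inner (kmetric j (coord j p)) (T u) (T v) =
    inner (kmetric i (coord i p)) u v).

Definition is_kahler (M : kahlerData) : Prop :=
  [/\ is_complex_manifold M, is_riemannian M
    & forall (i : chart (katlas M)) (x : 'rV[R]_(n + n)), coord_range i x ->
        (forall u v, inner (kmetric i x) (cplx u) (cplx v) =
                     inner (kmetric i x) u v) /\
        (forall u v w, 'D_u (fun y => kform i y v w) x +
                       'D_v (fun y => kform i y w u) x +
                       'D_w (fun y => kform i y u v) x = 0)].

Definition holomorphic_map (M M' : kahlerData) (D : set M) (F : M -> M') : Prop :=
  smooth_map (katlas M) (katlas M') D F /\
  forall (i : chart (katlas M)) (j : chart (katlas M')) (p : M),
    D p -> dom i p -> dom j (F p) -> forall v,
    tangent_map F i j p (cplx v) = cplx (tangent_map F i j p v).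

Definition isometric_map (M M' : kahlerData) (D : set M) (F : M -> M') : Prop :=
  forall (i : chart (katlas M)) (j : chart (katlas M')) (p : M),
    D p -> dom i p -> dom j (F p) -> forall u v,
    inner (kmetric j (coord j (F p))) (tangent_map F i j p u)
                                      (tangent_map F i j p v) =
    inner (kmetric i (coord i p)) u v.

Definition holomorphic_isometry (M : kahlerData) (F : M -> M) : Prop :=
  [/\ holomorphic_map setT F, isometric_map setT F
    & exists2 H : M -> M, cancel F H /\ cancel H F & holomorphic_map setT H].

Definition Aut0 (M : kahlerData) : set {compact-open, M -> M} :=
  connected_component
    ([set F | holomorphic_isometry F] : set {compact-open, M -> M}) id.

Definition smooth_function (M : kahlerData) (f : M -> R) : Prop :=
  smooth_map (katlas M) (vector_atlas R) setT f.

(* A vector field is given by its components in each chart.  The Killing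
   equation L_X g = 0 is evaluated on constant vector fields u, v, for which
   [X, u] = - D_u X. *)
Definition hamiltonian_field (M : kahlerData) (f : M -> R)
    (X : chart (katlas M) -> 'rV[R]_(n + n) -> 'rV[R]_(n + n)) : Prop :=
  forall (i : chart (katlas M)) x, coord_range i x ->
    forall v, kform i x (X i x) v = 'd (f \o param i) x v.

Definition killing_field (M : kahlerData)
    (X : chart (katlas M) -> 'rV[R]_(n + n) -> 'rV[R]_(n + n)) : Prop :=
  forall (i : chart (katlas M)) x, coord_range i x -> forall u v,
    'D_(X i x) (fun y => inner (kmetric i y) u v) x +
    inner (kmetric i x) ('D_u (X i) x) v +
    inner (kmetric i x) u ('D_v (X i) x) = 0.

Definition kahler_function (M : kahlerData) (f : M -> R) : Prop :=
  smooth_function f /\ exists2 X, hamiltonian_field f X & killing_field X.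

Definition critical_point (M : kahlerData) (f : M -> R) (p : M) : Prop :=
  forall i : chart (katlas M), dom i p ->
    forall v, 'd (f \o param i) (coord i p) v = 0.

Definition critical_values (M : kahlerData) (f : M -> R) : set R :=
  [set l | exists2 p, f p = l & critical_point f p].

(* Smooth curves suffice: a piecewise smooth curve can be reparametrized so as
   to stop at its corners and endpoints, without changing its length. *)
Definition riemannian_distance (M : kahlerData) (p q : M) : \bar R :=
  ereal_inf [set l | exists (gam : R -> M) (speed : R -> R),
    [/\ smooth_map (vector_atlas R) (katlas M) setT gam,
        gam 0 = p /\ gam 1 = q,
        forall (t : R) (i : chart (katlas M)), dom i (gam t) ->
          let v := derive1 (coord i \o gam) t in
          speed t = Num.sqrt (inner (kmetric i (coord i (gam t))) v v)
      & l = (\int[lebesgue_measure]_(t in `[0%R, 1%R]) (speed t)%:E)%E]].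

Definition complete_metric (M : kahlerData) : Prop :=
  forall u : nat -> M,
    (forall e : R, 0 < e -> exists k0 : nat, forall k l : nat,
       (k0 <= k)%N -> (k0 <= l)%N -> (riemannian_distance (u k) (u l) < e%:E)%E) ->
    exists p : M, u @ \oo --> p.

Definition analytic_metric (M : kahlerData) : Prop :=
  forall (i : chart (katlas M)) x, coord_range i x ->
    forall a b, analytic_at (fun y => kmetric i y a b) x.

Definition regular (M : kahlerData) : Prop :=
  [/\ connected [set: M], simply_connected R M, complete_metric M
    & analytic_metric M].

End Kahler.

Section Toric.
Variables (R : realType) (n : nat).

Definition integral_vector (a : 'rV[R]_n) : Prop :=
  forall i, a 0 i \is a Num.int.

(* An action of R^n / Z^n is an action of R^n that is trivial on Z^n; it is
   smooth on the torus iff it is smooth on R^n, the quotient map being a local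
   diffeomorphism. *)
Definition torus_action (M : kahlerData R n) (Phi : 'rV[R]_n -> M -> M) : Prop :=
  [/\ forall p, Phi 0 p = p,
      forall a b p, Phi (a + b) p = Phi a (Phi b p),
      forall a p, integral_vector a -> Phi a p = p
    & smooth_map (product_atlas (vector_atlas 'rV[R]_n) (katlas M)) (katlas M)
        setT (fun ap => Phi ap.1 ap.2)].

Definition effective (M : kahlerData R n) (Phi : 'rV[R]_n -> M -> M) : Prop :=
  forall a, (forall p, Phi a p = p) -> integral_vector a.

Definition free_locus (M : kahlerData R n) (Phi : 'rV[R]_n -> M -> M) : set M :=
  [set p | forall a, Phi a p = p -> integral_vector a].

Definition dotprod (u v : 'rV[R]_n) : R := \sum_k u 0 k * v 0 k.

Definition momentum_map (M : kahlerData R n) (Phi : 'rV[R]_n -> M -> M)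
    (J : M -> 'rV[R]_n) : Prop :=
  [/\ smooth_map (katlas M) (vector_atlas 'rV[R]_n) setT J,
      forall a p, J (Phi a p) = J p
    & forall (xi : 'rV[R]_n) (i : chart (katlas M)) (p : M), dom i p -> forall v,
        kform i (coord i p)
          (derive1 (fun t : R => coord i (Phi (t *: xi) p)) 0) v =
        'd (fun x => dotprod (J (param i x)) xi) (coord i p) v].

Definition is_kahler_toric (M : kahlerData R n) (Phi : 'rV[R]_n -> M -> M)
    (J : M -> 'rV[R]_n) : Prop :=
  [/\ connected [set: M] /\ compact [set: M], is_kahler M,
      torus_action Phi /\ effective Phi,
      forall a, holomorphic_isometry (Phi a)
    & momentum_map Phi J].

End Toric.

Section ExponentialFamily.
Variables (R : realType) (n : nat) (Omega : finType).

Definition exp_density (C : Omega -> R) (F : 'I_n -> Omega -> R)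
    (psi : 'rV[R]_n -> R) (theta : 'rV[R]_n) (x : Omega) : R :=
  expR (C x + \sum_k theta 0 k * F k x - psi theta).

Record expFamily := ExpFamily {
  efC : Omega -> R;
  efF : 'I_n -> Omega -> R;
  efpsi : 'rV[R]_n -> R;
  efP : forall theta, \sum_x exp_density efC efF efpsi theta x = 1;
  ef_free : forall (c0 : R) (c : 'I_n -> R),
    (forall x, c0 + \sum_k c k * efF k x = 0) ->
    c0 = 0 /\ forall k, c k = 0 }.

Variable E : expFamily.

Definition density (theta : 'rV[R]_n) : {ptws Omega -> R} :=
  exp_density (efC E) (efF E) (efpsi E) theta.

Definition expect (p : {ptws Omega -> R}) (X : Omega -> R) : R :=
  \sum_x X x * p x.

Definition estimator (x : Omega) : 'rV[R]_n := \row_k efF E k x.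

Definition affine_span : set (Omega -> R) :=
  [set X | exists (c0 : R) (c : 'I_n -> R),
     forall x, X x = c0 + \sum_k c k * efF E k x].

Definition prob_functions : set {ptws Omega -> R} :=
  [set p | (forall x, 0 <= p x) /\ \sum_x p x = 1].

Definition ef_closure : set {ptws Omega -> R} :=
  closure (range density) `&` prob_functions.

Definition fisher (theta : 'rV[R]_n) : 'M[R]_n :=
  \matrix_(i, j) expect (density theta) (fun x =>
    'D_(delta_mx 0 i) (fun t => ln (density t x)) theta *
    'D_(delta_mx 0 j) (fun t => ln (density t x)) theta).

(* A frame of vector fields on the family, in the chart theta: Y_i at theta is
   row i of Y theta.  The coordinates theta being affine for the exponential
   connection, its covariant derivative is the componentwise derivative. *)
Definition parallel_frame (Y : 'rV[R]_n -> 'M[R]_n) : Prop :=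
  forall theta, [/\ Y theta \in unitmx, differentiable Y theta
                  & forall v, 'D_v Y theta = 0].

(* Points of the tangent bundle are written (theta, thetadot) in R^(n + n). *)
Definition tshift (Y : 'rV[R]_n -> 'M[R]_n) (t : 'rV[R]_n)
    (u : 'rV[R]_(n + n)) : 'rV[R]_(n + n) :=
  u + row_mx 0 (t *m Y (lsubmx u)).

Section Quotient.
Variable Y : 'rV[R]_n -> 'M[R]_n.

Definition lattice_rel (u u' : 'rV[R]_(n + n)) : bool :=
  `[< exists2 k : 'rV[R]_n, integral_vector k & u' = tshift Y k u >].

Lemma tshift_base t u : lsubmx (tshift Y t u) = lsubmx u.
Proof. by rewrite /tshift linearD /= row_mxKl addr0. Qed.

Lemma tshiftD s t u : tshift Y s (tshift Y t u) = tshift Y (t + s) u.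
Proof.
by rewrite /(tshift Y s _) tshift_base /tshift -addrA add_row_mx addr0 mulmxDl.
Qed.

Lemma tshift0 u : tshift Y 0 u = u.
Proof. by rewrite /tshift mul0mx row_mx0 addr0. Qed.

Lemma lattice_rel_equiv : equiv_class_of lattice_rel.
Proof.
split=> [u | u u' | u' u u''].
- apply/asboolP; exists 0; last by rewrite tshift0.
  by move=> i; rewrite mxE rpred0.
- have lsym v v' : lattice_rel v v' -> lattice_rel v' v.
    move=> /asboolP [k ik ->]; apply/asboolP; exists (- k).
      by move=> i; rewrite mxE rpredN.
    by rewrite tshiftD addrN tshift0.
  by apply/idP/idP; apply: lsym.
- move=> /asboolP [k ik ->] /asboolP [l il ->]; apply/asboolP; exists (k + l).
    by move=> i; rewrite mxE rpredD.
  by rewrite tshiftD.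
Qed.

Canonical lattice_equiv := EquivRelPack lattice_rel_equiv.

Definition EL : topologicalType := quotient_topology {eq_quot lattice_equiv}.

Definition qL (u : 'rV[R]_(n + n)) : EL := \pi_({eq_quot lattice_equiv}) u.

Definition piL (e : EL) : 'rV[R]_n :=
  lsubmx (repr (e : {eq_quot lattice_equiv})).

(* The charts of the quotient are the inverses of the restrictions of qL to the
   open sets on which it is injective. *)
Definition EL_atlas : atlas 'rV[R]_(n + n) EL :=
  @Atlas R 'rV[R]_(n + n) EL {U | open U /\ set_inj U qL}
    (fun U => qL @` sval U)
    (fun U e => xget 0 [set u | sval U u /\ qL u = e])
    (fun=> qL).

Definition EL_kahler : kahlerData R n :=
  @KahlerData R n EL EL_atlas (fun _ u =>
    block_mx (fisher (lsubmx u)) 0 0 (fisher (lsubmx u))).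

End Quotient.

Section Torification.
Variables (N : kahlerData R n) (Phi : 'rV[R]_n -> N -> N).

Definition torification_data (Y : 'rV[R]_n -> 'M[R]_n) (G : EL_kahler Y -> N)
  : Prop :=
  [/\ parallel_frame Y,
      holomorphic_map setT G /\ isometric_map setT G,
      range G = free_locus Phi,
      exists2 H : N -> EL_kahler Y, cancel G H &
        smooth_map (katlas N) (katlas (EL_kahler Y)) (free_locus Phi) H
    & forall t u, G (qL Y (tshift Y t u)) = Phi t (G (qL Y u))].

Definition torification : Prop :=
  exists (Y : 'rV[R]_n -> 'M[R]_n) (G : EL_kahler Y -> N), torification_data G.

(* The values of kappa outside the free locus are irrelevant. *)
Definition compatible_projection (kappa : N -> {ptws Omega -> R}) : Prop :=
  exists (Y : 'rV[R]_n -> 'M[R]_n) (G : EL_kahler Y -> N),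
    torification_data G /\ forall e, kappa (G e) = density (piL e).

Definition natural_extension (K : N -> {ptws Omega -> R}) : Prop :=
  exists2 kappa, compatible_projection kappa &
    [/\ continuous K, forall p, ef_closure (K p)
      & forall p, free_locus Phi p -> K p = kappa p].

(* S is spec(f); the spectrum is a relation because it is defined through a
   choice of (K, phi, X), on which it does not depend if F is injective. *)
Definition is_spectrum (f : N -> R) (S : set R) : Prop :=
  exists (K : N -> {ptws Omega -> R}) (phi : N -> N) (X : Omega -> R),
    [/\ natural_extension K, @Aut0 R n N phi, affine_span X,
        forall p, f p = expect (K (phi p)) X
      & S = range X].

End Torification.
End ExponentialFamily.

(* Main.v *)
(* Write f = f0 o phi with f0(q) = E_{K(q)}(X) and X = c0 + sum_k c_k F_k.  At a
   point q of the free locus, the gradient of f0 is the image v of the constant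
   real vector c of the tangent bundle, and both df0(v) and g(v, v) are equal to
   the variance of X under K(q).  The free locus being dense, the identity
   |df0|^2 = Var_K(X) extends to N in the limit; hence at a critical point q of
   f0 the variance of X under K(q) vanishes, X is constant on the support of
   K(q), and f0(q) is the value of X there.

   Density of the free locus: a nontrivial stabilizer, being a closed subgroup of
   R^n that strictly contains Z^n, contains a rational non-integral vector.  A
   rational vector acts as a diffeomorphism of finite order, the interior of
   whose fixed locus is closed, hence empty by connectedness and effectiveness.
   Baire's theorem applied to the countably many rational vectors concludes. *)
From HB Require Import structures.
From mathcomp Require Import all_boot all_order all_algebra generic_quotient.
From mathcomp Require Import all_classical all_reals all_analysis.
From mathcomp Require Import ring lra zify.
Require Import Defs.

Set Implicit Arguments.
Unset Strict Implicit.
Unset Printing Implicit Defensive.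

Import Order.TTheory GRing.Theory Num.Theory numFieldNormedType.Exports.
Local Open Scope classical_set_scope.
Local Open Scope ring_scope.

(** * Maps of class C^1 *)

Section Calculus.
Variable R : realType.

Lemma ler_mx_entry m n (M : 'M[R]_(m, n)) i j : `|M i j| <= `|M|.
Proof.
rewrite [leRHS]/Num.Def.normr/= mx_normrE.
by apply/bigmax_geP; right; exists (i, j).
Qed.

Lemma mx_norm_le m n (M : 'M[R]_(m, n)) (e : R) :
  0 <= e -> (forall i j, `|M i j| <= e) -> `|M| <= e.
Proof.
move=> e0 Me; rewrite [leLHS]/Num.Def.normr/= mx_normrE.
by apply: bigmax_le => // -[i j] _; exact: Me.
Qed.

Lemma cvg_mxP (T : Type) (F : set_system T) (FF : Filter F) m n
    (f : T -> 'M[R]_(m, n)) (l : 'M[R]_(m, n)) :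
  (forall i j, f x i j @[x --> F] --> l i j) -> f x @[x --> F] --> l.
Proof.
move=> fl; apply/cvgrPdist_le => e e0; near=> x.
apply: mx_norm_le; first exact: ltW.
move=> i j; rewrite !mxE.
move: i j; near: x; apply: filter_forall => i; apply: filter_forall => j.
by have /cvgrPdist_le/(_ _ e0) := fl i j.
Unshelve. all: by end_near. Qed.

Lemma cvg_mx_entry (T : Type) (F : set_system T) (FF : Filter F) m n
    (f : T -> 'M[R]_(m, n)) (l : 'M[R]_(m, n)) i j :
  f x @[x --> F] --> l -> f x i j @[x --> F] --> l i j.
Proof.
move=> /cvgrPdist_le fl; apply/cvgrPdist_le => e e0.
apply: filterS (fl _ e0) => x; apply: le_trans.
by have := ler_mx_entry (l - f x) i j; rewrite !mxE.
Qed.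

Lemma cvg_sumr (T : Type) (F : set_system T) (FF : Filter F)
    (W : normedModType R) (I : finType) (f : I -> T -> W) (l : I -> W) :
  (forall i, f i x @[x --> F] --> l i) ->
  \sum_i f i x @[x --> F] --> \sum_i l i.
Proof. by move=> fl; apply: cvg_big => //; exact: add_continuous. Qed.

Lemma mulmxr_continuous p m (Q : 'M[R]_(p, m)) :
  continuous (fun x : 'rV[R]_p => x *m Q).
Proof.
move=> x; suff : y *m Q @[y --> x] --> x *m Q by [].
apply: (@cvg_mxP _ (nbhs x)) => i j; rewrite mxE.
rewrite [X in X @ _ --> _](_ : _ =
  fun y : 'rV[R]_p => \sum_k y i k * Q k j); last first.
  by apply/funext => y; rewrite mxE.
apply: (@cvg_sumr _ (nbhs x)) => l; apply: cvgMr_tmp.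
exact: (@cvg_mx_entry _ (nbhs x) _ _ _ id x i l cvg_id).
Qed.

Lemma derive_coordE (W : normedModType R) d (f : 'rV[R]_d -> W) x v :
  differentiable f x ->
  'D_v f x = \sum_k v 0 k *: 'D_(delta_mx 0 k) f x.
Proof.
move=> df; rewrite deriveE// [in LHS](row_sum_delta v) linear_sum.
by apply: eq_bigr => k _; rewrite linearZ deriveE.
Qed.

(** Continuity of the differential is asked at the point [x] only and along each fixed direction,
    which avoids a norm on linear maps; in finite dimension this is continuity of the differential
    at [x]. *)
Definition C1_at (V W : normedModType R) (x : V) (f : V -> W) : Prop :=
  (\forall y \near x, differentiable f y) /\
  forall v, {for x, continuous (fun y => 'D_v f y)}.

Lemma smooth_at_C1 (V W : normedModType R) (x : V) (f : V -> W) :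
  smooth_at x f -> C1_at x f.
Proof.
move=> [U [oU Ux] sf]; have [dU cU] := sf 1%N; split.
  by apply: filterS (open_nbhs_nbhs (conj oU Ux)).
by move=> v; exact: cU.
Qed.

Lemma C1_at_differentiable (V W : normedModType R) (x : V) (f : V -> W) :
  C1_at x f -> differentiable f x.
Proof. by move=> [/nbhs_singleton]. Qed.

Lemma C1_at_continuous (V W : normedModType R) (x : V) (f : V -> W) :
  C1_at x f -> {for x, continuous f}.
Proof. by move/C1_at_differentiable/differentiable_continuous. Qed.

Lemma derive_comp (U V W : normedModType R) (g : U -> V) (f : V -> W) x v :
  differentiable g x -> differentiable f (g x) ->
  'D_v (f \o g) x = 'D_('D_v g x) f (g x).
Proof.
move=> dg df; rewrite deriveE; last exact: differentiable_comp.
by rewrite diff_comp//= (deriveE _ dg) deriveE.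
Qed.

(** The direction ['D_v g y] varies with [y], whereas [C1_at] controls fixed directions only.
    Expanding it in the standard basis of the middle space leaves finitely many fixed directions of
    [f]. *)
Lemma C1_at_comp (U W : normedModType R) d (g : U -> 'rV[R]_d)
    (f : 'rV[R]_d -> W) x :
  C1_at x g -> C1_at (g x) f -> C1_at x (f \o g).
Proof.
move=> cg cf; have cgx := C1_at_continuous cg.
case: (cg) (cf) => dg cDg [df cDf].
have dfg : \forall y \near x, differentiable f (g y) by exact: cgx df.
split; first by near do apply: differentiable_comp.
move=> v; suff : 'D_v (f \o g) y @[y --> x] --> 'D_v (f \o g) x by [].
rewrite derive_comp; [|exact: nbhs_singleton dg|exact: nbhs_singleton dfg].
rewrite (derive_coordE _ (nbhs_singleton dfg)).
have : \forall y \near x, \sum_k 'D_v g y 0 k *: 'D_(delta_mx 0 k) f (g y) =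
    'D_v (f \o g) y.
  near=> y.
  have dgy : differentiable g y by near: y.
  have dfy : differentiable f (g y) by near: y.
  by rewrite (derive_comp v dgy dfy) (derive_coordE _ dfy).
move=> Efg; apply: (cvg_trans (near_eq_cvg Efg)).
apply: cvg_sumr => k; apply: cvgZ.
  by apply: cvg_mx_entry; exact: cDg.
exact: (cvg_comp _ _ cgx (cDf _)).
Unshelve. all: by end_near. Qed.

(** The partial derivatives of [g] minus the identity are small on a ball around [x0]. As the ball
    is convex, the mean value theorem applies to each coordinate along the segment from [y] to
    [x]. *)
Lemma C1_at_id_strict d (g : 'rV[R]_d -> 'rV[R]_d) x0 (e : R) :
  C1_at x0 g -> (forall v, 'D_v g x0 = v) -> 0 < e ->
  exists2 r : R, 0 < r & forall x y, `|x - x0| < r -> `|y - x0| < r ->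
    `|g x - g y - (x - y)| <= e * `|x - y|.
Proof.
move=> [dg cDg] Dg0 e0.
(* The bound is summed over [d] partial derivatives; dividing by [d.+1] also covers [d = 0]. *)
have ed0 : 0 < e / d.+1%:R by rewrite divr_gt0.
have : \forall x \near x0, differentiable g x /\
    forall k : 'I_d, `|'D_(delta_mx 0 k) g x - delta_mx 0 k| <= e / d.+1%:R.
  near=> x; split; first by near: x.
  near: x; apply: filter_forall => k.
  have /cvgrPdist_le/(_ _ ed0) := cDg (delta_mx 0 k); rewrite Dg0.
  by apply: filterS => x; rewrite distrC.
move=> /nbhs_normP[r /= r0 rP]; exists r => // x y xr yr.
have seg (t : R) : t \in `[0, 1]%R -> `|(y + t *: (x - y)) - x0| < r.
  rewrite in_itv/= => /andP[t0 t1].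
  have -> : y + t *: (x - y) - x0 = t *: (x - x0) + (1 - t) *: (y - x0).
    by apply/matrixP => i j; rewrite !mxE; ring.
  apply: le_lt_trans (ler_normD _ _) _; rewrite !normrZ.
  have t1' : 0 <= 1 - t by rewrite subr_ge0.
  rewrite (ger0_norm t0) (ger0_norm t1').
  by have [ab|ab] := leP `|x - x0| `|y - x0|; nra.
have segP (t : R) : t \in `[0, 1]%R -> differentiable g (y + t *: (x - y)) /\
    forall k : 'I_d, `|'D_(delta_mx 0 k) g (y + t *: (x - y)) - delta_mx 0 k| <= e / d.+1%:R.
  by move=> /seg tr; apply: rP; rewrite /ball_/= distrC.
apply: mx_norm_le => [|i l]; first by rewrite mulr_ge0// ltW.
have -> : (g x - g y - (x - y)) i l = g x 0 l - g y 0 l - (x 0 l - y 0 l).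
  by rewrite ord1 !mxE.
pose v : 'rV[R]_d := x - y.
pose h (t : R) : R := g (y + t *: v) 0 l.
pose dh (t : R) : R := 'D_v g (y + t *: v) 0 l.
have hder (t : R) : t \in `[0, 1]%R -> is_derive t 1 h (dh t).
  move=> /segP[dgt _].
  have dc : differentiable (fun M : 'rV[R]_d => M 0 l) (g (y + t *: v)).
    exact: differentiable_coord.
  have da : differentiable (fun t : R => y + t *: v) t by [].
  have dhh : differentiable h t.
    rewrite (_ : h = (fun M : 'rV[R]_d => M 0 l) \o (g \o fun t => y + t *: v))//.
    by apply: differentiable_comp => //; apply: differentiable_comp.
  split; first exact: diff_derivable.
  rewrite [LHS](@derive_comp R _ _ (fun t : R => y + t *: v) (fun z => g z 0 l))//; last first.
    exact: (@differentiable_comp _ _ _ _ g (fun M : 'rV[R]_d => M 0 l)).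
  rewrite (_ : 'D_1 _ t = v); last by rewrite deriveE// diff_val/= add0r scale1r.
  by rewrite /dh derive_mx ?mxE//; exact: diff_derivable.
have hcont : {within `[0, 1], continuous h}.
  apply: derivable_within_continuous => t t01.
  exact: (@ex_derive _ _ _ _ _ _ _ (hder t t01)).
have [t t01 ] := @MVT_segment _ h dh 0 1 ler01
  (fun z hz => hder z (subset_itv_oo_cc hz)) hcont.
have yvx : y + 1 *: v = x by rewrite scale1r /v addrC subrK.
rewrite /h scale0r addr0 yvx subr0 mulr1 => ->.
have [dgt Dgt] := segP t t01.
rewrite /dh (derive_coordE _ dgt) summxE.
have -> : x 0 l - y 0 l = \sum_k (v 0 k *: (delta_mx 0 k : 'rV[R]_d)) 0 l.
  by rewrite -summxE -row_sum_delta !mxE.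
rewrite -sumrB; apply: le_trans (ler_norm_sum _ _ _) _.
apply: (@le_trans _ _ (\sum_(k < d) `|v| * (e / d.+1%:R))).
  apply: ler_sum => k _.
  have -> (A B : 'rV[R]_d) (c : R) : (c *: A) 0 l - (c *: B) 0 l = c * (A - B) 0 l.
    by rewrite !mxE mulrBr.
  rewrite normrM; apply: ler_pM => //; first exact: ler_mx_entry.
  by apply: le_trans (Dgt k); exact: ler_mx_entry.
rewrite sumr_const card_ord -[leLHS]mulr_natr -/v.
rewrite -mulrA mulrC ler_wpM2r// -[leRHS]mulr1 -mulrA ler_wpM2l ?(ltW e0)//.
rewrite ler_pdivrMl// mulr1 ler_nat.
exact: leqnSn.
Unshelve. all: by end_near. Qed.

End Calculus.

(** * Closed subgroups of R^n containing Z^n *)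

Section ClosedSubgroups.
Variables (R : realType) (n : nat).
Implicit Types (H : set 'rV[R]_n) (a v : 'rV[R]_n).

(** A cluster point is approached at arbitrarily late indices; this takes the place of a convergent
    subsequence. *)
Lemma compact_recurrent (K : set 'rV[R]_n) (u : nat -> 'rV[R]_n) :
  compact K -> (forall j, K (u j)) ->
  exists2 l, K l & forall (e : R) N, 0 < e ->
    exists2 j, (N <= j)%N & `|u j - l| < e.
Proof.
move=> cK Ku.
have [|l [Kl cl]] := cK (u @ \oo) _.
  by exists 0%N => // j _; exact: Ku.
exists l => // e N e0.
have [| |x [[j /= Nj <-]]] := cl (u @` [set j | (N <= j)%N]) (ball l e).
- by exists N => // j /= Nj; exists j.
- exact: nbhsx_ballx.
by rewrite -ball_normE/= distrC; exists j.
Qed.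

(** The fractional parts of the multiples [j v] lie in the compact unit cube, so two of them are
    closer than [e]; the difference of the two indices is [k]. *)
Lemma dirichlet_approximation v (e : R) : 0 < e ->
  exists k m, [/\ (0 < k)%N, integral_vector m & `|k%:R *: v - m| < e].
Proof.
move=> e0.
pose m j : 'rV[R]_n := \row_i (Num.floor (j%:R * v 0 i))%:~R.
pose u j : 'rV[R]_n := j%:R *: v - m j.
have cK : compact [set w : 'rV[R]_n | forall i, w ord0 i \in `[(0 : R), 1]].
  by apply: (@rV_compact _ _ (fun=> `[(0 : R), 1]%classic)) => _; exact: segment_compact.
have Ku j : [set w : 'rV[R]_n | forall i, w ord0 i \in `[(0 : R), 1]] (u j).
  move=> i; rewrite /u /m !mxE in_itv/=.
  have := floor_itv (j%:R * v 0 i); rewrite intrD => /andP[? ?].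
  apply/andP; split; lra.
have [l _ lP] := compact_recurrent cK Ku.
have e20 : 0 < e / 2 by rewrite divr_gt0.
have [j1 _ h1] := lP _ 0%N e20.
have [j2 j12 h2] := lP _ j1.+1 e20.
exists (j2 - j1)%N, (m j2 - m j1); split.
- by rewrite subn_gt0.
- by move=> i; rewrite !mxE rpredB// intr_int.
- rewrite natrB; last exact: ltnW.
  have -> : (j2%:R - j1%:R) *: v - (m j2 - m j1) = (u j2 - l) - (u j1 - l).
    by rewrite /u scalerBl; apply/matrixP => x y; rewrite !mxE; ring.
  by apply: le_lt_trans (ler_normB _ _) _; lra.
Qed.

Lemma subgroup_zmul H :
  H 0 -> (forall a b, H a -> H b -> H (a - b)) ->
  forall (z : int) a, H a -> H (z%:~R *: a).
Proof.
move=> H0 HB; have HN a : H a -> H (- a) by move=> Ha; rewrite -[- a]sub0r; exact: HB.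
have Hn k a : H a -> H (k%:R *: a).
  move=> Ha; elim: k => [|k IH]; first by rewrite scale0r.
  by rewrite -natr1 scalerDl scale1r -[a in _ + a]opprK; apply/HB/HN.
case=> k a Ha; first exact: Hn.
by rewrite NegzE mulrNz scaleNr; apply/HN/Hn.
Qed.

(* The multiples of a short element w of H are |w|-dense in the line R w, so a
   limit direction of ever shorter elements spans a line contained in H. *)
Lemma closed_subgroup_line H (W : set 'rV[R]_n) :
  closed H -> H 0 -> (forall a b, H a -> H b -> H (a - b)) ->
  closed W -> (forall (c : R) w, W w -> W (c *: w)) ->
  (forall e : R, 0 < e -> exists w, [/\ H w, W w, w != 0 & `|w| < e]) ->
  exists u, [/\ W u, u != 0 & forall s : R, H (s *: u)].
Proof.
move=> cH H0 HB cW WZ small.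
have /choice[w wP] : forall j : nat,
    exists w, [/\ H w, W w, w != 0 & `|w| < j.+1%:R^-1].
  by move=> j; apply: small; rewrite invr_gt0.
have w0 j : 0 < `|w j| by rewrite normr_gt0; have [] := wP j.
pose u j := `|w j|^-1 *: w j.
have u1 j : `|u j| = 1.
  by rewrite normrZ normfV normr_id mulVf// gt_eqF.
have cS : compact ([set x : 'rV[R]_n | `|x| = 1] `&` W).
  apply: bounded_closed_compact.
    by exists 1; split => // M M1 x [/= -> _]; exact: ltW.
  apply: closedI => //.
  apply: (@preimage_closed _ _ (fun x : 'rV[R]_n => `|x|) [set 1 : R]).
    by move=> x _; exact: norm_continuous.
  exact: closed_eq.
have Su j : ([set x : 'rV[R]_n | `|x| = 1] `&` W) (u j).
  by split => /=; [exact: u1|apply: WZ; have [] := wP j].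
have [l [/= l1 Wl] lP] := compact_recurrent cS Su.
exists l; split => //; first by rewrite -normr_gt0 l1.
move=> s; apply: cH => B /nbhs_normP[e /= e0 eB].
have e20 : 0 < e / 2 by rewrite divr_gt0.
have s10 : 0 < `|s| + 1 by rewrite ltr_pwDr.
(* The index makes [w j] shorter than [e / 2], and the direction error, once multiplied by [s], is
   at most [e / 2]. The summand 1 covers [s = 0]. *)
have [j Nj jl] := lP (e / 2 / (`|s| + 1)) (Num.truncn (e / 2)^-1) (divr_gt0 e20 s10).
have [Hw _ _ wj] := wP j.
have we : `|w j| < e / 2.
  apply: lt_le_trans wj _; rewrite invf_ple ?posrE// ltW//.
  apply: lt_le_trans (truncnS_gt _) _; by rewrite ler_nat ltnS.
pose z := Num.floor (s / `|w j|).
exists (z%:~R *: w j); split; first exact: subgroup_zmul.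
apply: eB; rewrite /ball_/=.
have -> : s *: l - z%:~R *: w j =
    (s - z%:~R * `|w j|) *: u j - s *: (u j - l).
  rewrite /u scalerBl scalerBr !scalerA -mulrA mulfV ?gt_eqF// mulr1.
  by apply/matrixP => x y; rewrite !mxE; ring.
apply: le_lt_trans (ler_normB _ _) _; rewrite normrZ u1 mulr1 normrZ.
have h1 : `|s - z%:~R * `|w j| | <= `|w j|.
  have := floor_itv (s / `|w j|); rewrite -/z intrD.
  rewrite ler_pdivlMr// ltr_pdivrMr// => /andP[? ?].
  by rewrite ger0_norm; lra.
have h2 : `|s| * `|u j - l| <= e / 2.
  apply: (@le_trans _ _ ((`|s| + 1) * (e / 2 / (`|s| + 1)))).
    by apply: ler_pM => //; [lra|exact: ltW].
  by rewrite mulrC divfK// gt_eqF.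
lra.
Qed.

(** Take [V] of maximal rank among the subspaces contained in [H]. If arbitrarily short elements of
    [H] lay outside [V], their projections to a complement of [V] would be short nonzero elements of
    [H], and [closed_subgroup_line] would give a line in that complement by which [V] could be
    enlarged. *)
Lemma closed_subgroup_subspace H :
  closed H -> H 0 -> (forall a b, H a -> H b -> H (a - b)) ->
  exists (V : 'M[R]_n) (e : R), [/\ 0 < e, forall v, (v <= V)%MS -> H v
    & forall h, H h -> `|h| < e -> (h <= V)%MS].
Proof.
move=> cH H0 HB.
pose P k := `[< exists V : 'M[R]_n, \rank V = k /\
  forall v : 'rV[R]_n, (v <= V)%MS -> H v >].
have exP : exists k, P k.
  exists 0%N; apply/asboolP; exists 0; split; first exact: mxrank0.
  by move=> v; rewrite submx0 => /eqP ->.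
have leP k : P k -> (k <= n)%N by move=> /asboolP[V [<- _]]; exact: rank_leq_row.
case: (ex_maxnP exP leP) => k /asboolP[V [rV HV]] kmax.
exists V; apply: contrapT => noe.
pose Q := proj_mx (V^C)%MS V.
have dC : ((V^C) :&: V = 0)%MS by rewrite capmxC; exact: capmx_compl.
have split_h (h : 'rV[R]_n) : (h - h *m Q <= V)%MS.
  have <- : h *m proj_mx V (V^C)%MS = h - h *m Q.
    apply/(canRL (addrK _)); apply: add_proj_mx; first exact: capmx_compl.
    by apply: submx_full; exact: addsmx_compl_full.
  exact: proj_mx_sub.
have cQ : continuous (fun x : 'rV[R]_n => x *m Q) by exact: mulmxr_continuous.
(* The complement is presented as the fixed set of the projection [Q], so that its closedness
   follows from continuity. *)
have [| |e e0|u [Wu u0 Hu]] := @closed_subgroup_line H [set w | w *m Q = w] cH H0 HB.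
- have -> : [set w : 'rV[R]_n | w *m Q = w] =
      (fun w : 'rV[R]_n => `|w *m Q - w|) @^-1` [set (0 : R)].
    apply/seteqP; split => w /= => [->|/eqP]; first by rewrite subrr normr0.
    by rewrite normr_eq0 subr_eq0 => /eqP.
  apply: preimage_closed; last exact: closed_eq.
  move=> w _; apply: (@cvg_norm _ _ _ (nbhs w)).
  by apply: cvgB; [exact: cQ|exact: cvg_id].
- by move=> c w /= Ww; rewrite -scalemxAl Ww.
- have /cvgrPdist_lt/(_ _ e0) := cQ 0.
  rewrite mul0mx => /nbhs_normP[d /= d0 dP].
  have [h [Hh hd hV]] : exists h, [/\ H h, `|h| < d & ~~ (h <= V)%MS].
    apply: contrapT => noh; apply: noe; exists d; split => // h Hh hd.
    by apply: contrapT => /negP hV; apply: noh; exists h.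
  exists (h *m Q); split.
  + by rewrite -[h *m Q](subKr h); apply: HB => //; apply: HV; exact: split_h.
  + by rewrite /= proj_mx_id//; exact: proj_mx_sub.
  + by apply: contra hV => /eqP hQ; have := split_h h; rewrite hQ subr0.
  + by have := dP h; rewrite /ball_/= !sub0r !normrN; exact.
have uC : (u <= V^C)%MS by rewrite -Wu; exact: proj_mx_sub.
have : P (\rank (V + u)%MS).
  apply/asboolP; exists (V + u)%MS; split => // v /sub_addsmxP[[a b]/= ->].
  rewrite -[b *m u]opprK; apply: HB; first by apply: HV; exact: submxMl.
  by rewrite [b]mx11_scalar mul_scalar_mx -scaleNr.
move/kmax; rewrite -rV leqNgt => /negP; apply.
apply: rank_ltmx; rewrite ltmxE addsmxSl/= addsmx_sub submx_refl/=.
apply: contra u0 => uV.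
by rewrite -submx0 -dC sub_capmx uC.
Qed.

Lemma integral_vectorP a : integral_vector a -> exists z : 'I_n -> int,
  forall i, a 0 i = (z i)%:~R.
Proof. by move=> ia; exists (fun i => Num.floor (a 0 i)) => i; rewrite floorK. Qed.

(** If [H] is discrete, a short difference [k a - m] must vanish and [a] itself is rational.
    Otherwise [H] contains a nonzero subspace [V]; approximating a multiple of a unit vector of [V]
    yields a nonzero integral vector in [V], and a suitable multiple of it has a coordinate equal to
    [1 / 2]. *)
Lemma closed_subgroup_rational H a :
  closed H -> (forall b c, H b -> H c -> H (b - c)) ->
  (forall b, integral_vector b -> H b) -> H a -> ~ integral_vector a ->
  exists r : 'rV[rat]_n,
    H (map_mx ratr r) /\ ~ integral_vector (map_mx ratr r : 'rV[R]_n).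
Proof.
move=> cH HB HZ Ha nia.
have H0 : H 0 by apply: HZ => i; rewrite mxE.
have [V [e [e0 HV Ve]]] := closed_subgroup_subspace cH H0 HB.
have [V0|Vn0] := eqVneq V 0.
  have [k [m [k0 im km]]] := dirichlet_approximation a e0.
  have : (k%:R *: a - m <= V)%MS.
    by apply: Ve km; apply: (HB _ _ _ (HZ _ im)); exact: (subgroup_zmul H0 HB k Ha).
  rewrite V0 submx0 subr_eq0 => /eqP kam.
  have [z zP] := integral_vectorP im.
  exists (\row_i ((z i)%:~R / k%:R)).
  suff -> : map_mx ratr (\row_i ((z i)%:~R / k%:R)) = a by [].
  apply/rowP => i; rewrite !mxE fmorph_div/= ratr_int ratr_nat -zP -kam mxE.
  by rewrite mulrC mulKf// pnatr_eq0 -lt0n.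
have [v vV v0] : exists2 v : 'rV[R]_n, (v <= V)%MS & `|v| = 1.
  have /rowV0Pn[v vV v0] := Vn0; exists (`|v|^-1 *: v); first exact: scalemx_sub.
  by rewrite normrZ normfV normr_id mulVf// normr_eq0.
(* The bound [e] puts [k v - m], hence [m], in [V]; the bound [1 / 2] keeps [m] nonzero, since [k v]
   has norm at least 1. *)
have e'0 : 0 < Num.min e (1 / 2) by rewrite lt_min e0 divr_gt0.
have [k [m [k0 im]]] := dirichlet_approximation v e'0.
rewrite lt_min => /andP[ke kh].
have mV : (m <= V)%MS.
  have : (k%:R *: v - m <= V)%MS.
    by apply: Ve ke; apply: (HB _ _ _ (HZ _ im)); apply: HV; exact: scalemx_sub.
  move=> kvm; rewrite -[m](subKr (k%:R *: v)) addmx_sub ?eqmx_opp//.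
  exact: scalemx_sub.
have [z zP] := integral_vectorP im.
have /rV0Pn[i mi0] : m != 0.
  apply/eqP => m0; move: kh; rewrite m0 subr0 normrZ v0 mulr1 normr_nat.
  have : (1 : R) <= k%:R by rewrite ler1n.
  lra.
have zi0 : z i != 0 by rewrite zP intr_eq0 in mi0.
exists (\row_l ((z l)%:~R / (2 * (z i)%:~R))).
have -> : map_mx ratr (\row_l ((z l)%:~R / (2 * (z i)%:~R))) =
    (2 * (z i)%:~R)^-1 *: m :> 'rV[R]_n.
  apply/rowP => l; rewrite !mxE fmorph_div/= rmorphM/= !ratr_int ratr_nat.
  by rewrite zP mulrC.
split; first by apply: HV; exact: scalemx_sub.
have zR0 : (z i)%:~R != 0 :> R by rewrite intr_eq0.
move=> /(_ i); rewrite mxE zP invfM -mulrA mulVf// mulr1.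
move=> /intrP[t /(congr1 ( *%R^~ 2))]; rewrite mulVf ?pnatr_eq0// => t2.
have /eqP : 1 = t * 2 :> int by apply: (@intr_inj R); rewrite intrM.
by lia.
Qed.

End ClosedSubgroups.

(** * Fixed points of diffeomorphisms of finite order *)

Section FixedPoints.
Variable R : realType.

(* The increments of an almost-translation barely change, so they cannot sum to
   zero over a period unless they vanish. *)
Lemma periodic_increments (V : normedModType R) (x : nat -> V) m :
  (0 < m)%N -> x m = x 0%N ->
  (forall k, (k.+1 < m)%N -> `|(x k.+2 - x k.+1) - (x k.+1 - x k)| <=
     (4 * m%:R)^-1 * `|x k.+1 - x k|) ->
  x 1%N = x 0%N.
Proof.
move=> m0 xm step; pose d k := x k.+1 - x k; pose c : R := `|d 0%N|.
have mR : 0 < m%:R :> R by rewrite ltr0n.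
have c0 : 0 <= c by exact: normr_ge0.
have half k : (k <= m)%N -> k%:R / (2 * m%:R) <= 1 / 2 :> R.
  move=> km; rewrite ler_pdivrMr ?mulr_gt0//.
  by have : k%:R <= m%:R :> R by [rewrite ler_nat]; lra.
(* As long as the drift is at most [c / 2], every increment has norm at most [2 c], so one more step
   adds at most [2 c / (4 m)]. *)
have dk k : (k < m)%N -> `|d k - d 0%N| <= k%:R / (2 * m%:R) * c.
  elim: k => [_|k IH km]; first by rewrite subrr normr0 mul0r mul0r.
  have {}IH := IH (ltnW km).
  have hk := half k (ltnW (ltnW km)).
  have dk2 : `|d k| <= 2 * c.
    have -> : d k = (d k - d 0%N) + d 0%N by rewrite subrK.
    by apply: le_trans (ler_normD _ _) _; rewrite -/c; nra.
  have st := step k km.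
  have -> : d k.+1 - d 0%N = (d k.+1 - d k) + (d k - d 0%N) by rewrite subrKA.
  apply: le_trans (ler_normD _ _) _.
  have -> : k.+1%:R / (2 * m%:R) * c =
      (4 * m%:R)^-1 * (2 * c) + k%:R / (2 * m%:R) * c.
    by rewrite -natr1; field; rewrite gt_eqF.
  apply: lerD => //; apply: le_trans st _.
  by rewrite ler_wpM2l// invr_ge0 mulr_ge0// ltW.
have sum0 : \sum_(k < m) d k = 0.
  rewrite -(big_mkord xpredT d) /d telescope_sumr// xm subrr//.
(* The increments sum to zero, so [m] times the first one is minus the total drift. This gives
   [m c <= m c / 2], hence [c = 0]. *)
have : `|d 0%N *+ m| <= m%:R * (1 / 2 * c).
  have -> : d 0%N *+ m = - \sum_(k < m) (d k - d 0%N).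
    by rewrite sumrB sum0 sumr_const card_ord sub0r opprK.
  rewrite normrN; apply: le_trans (ler_norm_sum _ _ _) _.
  rewrite mulr_natl -[in leRHS](card_ord m) -sumr_const.
  apply: ler_sum => k _; apply: le_trans (dk k (ltn_ord k)) _.
  by apply: ler_wpM2r => //; apply: half; exact: ltnW.
rewrite -scaler_nat normrZ normr_nat -/c => cle.
have : c = 0 by nra.
by move/eqP; rewrite normr_eq0 subr_eq0 => /eqP.
Qed.

Variables (d : nat) (M : topologicalType) (A : atlas 'rV[R]_d M).
Hypothesis mA : is_manifold A.

Lemma nbhs_chart (i : chart A) p (B : set 'rV[R]_d) :
  dom i p -> nbhs (coord i p) B -> \forall p' \near p, dom i p' /\ B (coord i p').
Proof.
move=> ip Bp; have [_ _ _ /(_ i)[oi _ _ ci _] _] := mA.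
near=> p'; split; near: p'; first exact: open_nbhs_nbhs.
exact: ci ip _ Bp.
Unshelve. all: by end_near. Qed.

Lemma coordK (i : chart A) x : coord_range i x -> coord i (param i x) = x.
Proof.
have [_ _ _ /(_ i)[_ _ K _ _] _] := mA.
by move=> [p ip <-]; rewrite K.
Qed.

Lemma param_dom (i : chart A) x : coord_range i x -> dom i (param i x).
Proof.
have [_ _ _ /(_ i)[_ _ K _ _] _] := mA.
by move=> [p ip <-]; rewrite K.
Qed.

Lemma paramK (i : chart A) p : dom i p -> param i (coord i p) = p.
Proof. by have [_ _ _ /(_ i)[_ _ K _ _] _] := mA; exact: K. Qed.

Lemma open_param_preimage (i : chart A) (O : set M) :
  open O -> open [set x | coord_range i x /\ O (param i x)].
Proof.
move=> oO; have [_ _ _ /(_ i)[_ or _ _ cp] _] := mA.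
rewrite openE => x [rx Ox]; rewrite /interior/=.
near=> y; split; near: y; first exact: open_nbhs_nbhs.
by apply: cp rx _ _; exact: open_nbhs_nbhs.
Unshelve. all: by end_near. Qed.

Lemma closed_fixed (phi : M -> M) :
  continuous phi -> closed [set p | phi p = p].
Proof.
move=> cphi q clq; have [hM _ _ _ _] := mA.
apply: hM => B C Bq Cq.
have [p [/= pp [Bp Cp]]] : [set p | phi p = p] `&` (phi @^-1` B `&` C) !=set0.
  by apply: clq; apply: filterI => //; exact: cphi.
by exists p; split => //; rewrite -pp.
Qed.

Lemma iter_fixed_continuous (phi : M -> M) q k : continuous phi -> phi q = q ->
  iter k phi p @[p --> q] --> q.
Proof.
move=> cphi qq; elim: k => [|k IH]; first exact: cvg_id.
by rewrite -[X in _ --> X]qq; exact: cvg_comp IH (cphi q).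
Qed.

(** At a limit [q] of interior fixed points, the derivative of [phi] in a chart is the identity.
    Near [q] the map is therefore almost a translation, and by [periodic_increments] an orbit of
    period [m] cannot move, so [q] is itself interior. *)
Lemma finite_order_fixed_interior_closed (phi : M -> M) m :
  smooth_map A A setT phi -> (0 < m)%N -> (forall p, iter m phi p = p) ->
  closed [set p | phi p = p]°.
Proof.
move=> sphi m0 phim q clq.
have cphi : continuous phi by move=> p; have [] := sphi p I.
have qq : phi q = q.
  apply: (closed_fixed cphi) => B /clq[p [/interior_subset pp Bp]].
  by exists p.
have [_ _ exi /(_ _) chi _] := mA.
have [i iq] := exi q.
have [oi or K ci cp] := chi i.
pose x0 := coord i q; pose g := coord i \o phi \o param i.
have Cg : C1_at x0 g.
  by apply: smooth_at_C1; have [_] := sphi q I; apply => //; rewrite qq.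
(* At interior fixed points [g] is locally the identity and ['D_v g] is [v]; such points accumulate
   at [q], and ['D_v g] is continuous at [x0]. *)
have Dg v : 'D_v g x0 = v.
  apply/eqP; rewrite eq_sym -subr_eq0 -normr_eq0 eq_le normr_ge0 andbT.
  apply/ler_addgt0Pr => e e0; rewrite add0r.
  have /cvgrPdist_le/(_ _ e0) := Cg.2 v => /(nbhs_chart iq) /clq[p [Fp [ip]]].
  suff -> : 'D_v g (coord i p) = v by rewrite distrC.
  rewrite -[RHS](derive_id (coord i p) v); apply: near_eq_derive.
  have rp : coord_range i (coord i p) by exists p.
  have Fp' : nbhs (param i (coord i p)) [set z | phi z = z] by rewrite K.
  near=> y.
  have ry : coord_range i y by near: y; exact: open_nbhs_nbhs.
  have Fy : phi (param i y) = param i y.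
    by near: y; exact: (cp _ rp _ Fp').
  by rewrite /g/= Fy coordK.
have e0 : 0 < (4 * m%:R)^-1 :> R by rewrite invr_gt0 mulr_gt0// ltr0n.
have [r r0 rP] := C1_at_id_strict Cg Dg e0.
have nb k : \forall p \near q, dom i (iter k phi p) /\ `|coord i (iter k phi p) - x0| < r.
  have Br : nbhs (coord i q) [set y | `|y - x0| < r].
    apply: filterS (nbhsx_ballx (coord i q) r r0) => y.
    by rewrite -ball_normE/= distrC.
  exact: (iter_fixed_continuous k cphi qq (nbhs_chart iq Br)).
(* A single neighbourhood of [q] must keep the first [m] iterates in the chart and in the ball where
   the increments are controlled. *)
have : \forall p \near q, forall k : 'I_m.+1,
    dom i (iter k phi p) /\ `|coord i (iter k phi p) - x0| < r.
  by apply: filter_forall => k; exact: nb.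
apply: filterS => p pk.
have {}pk k : (k <= m)%N -> dom i (iter k phi p) /\ `|coord i (iter k phi p) - x0| < r.
  by move=> km; have := pk (Ordinal (km : (k < m.+1)%N)).
have := @periodic_increments _ (fun k => coord i (iter k phi p)) m m0.
rewrite /= phim => /(_ erefl) H.
have : coord i (phi p) = coord i p.
  apply: H => k km.
  have gk l : (l <= m)%N -> g (coord i (iter l phi p)) = coord i (phi (iter l phi p)).
    by move=> lm; rewrite /g/= K//; have [] := pk l lm.
  have h1 := pk k (ltnW (ltnW km)); have h2 := pk k.+1 (ltnW km).
  have := rP _ _ h2.2 h1.2.
  by rewrite gk ?(gk k) ?(ltnW km) ?(ltnW (ltnW km)).
move/(congr1 (param i)); rewrite !K//.
  by have [] := pk 0%N (leq0n _).
by have [] := pk 1%N m0.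
Unshelve. all: by end_near. Qed.

End FixedPoints.

(** * Density of the free locus *)

(** This equips row vectors with the completeness that Baire's theorem requires. *)
HB.instance Definition _ (R : realType) (m n : nat) :=
  Uniform_isComplete.Build 'M[R]_(m, n) (@mx_complete R m n).

Section FreeLocus.
Variables (R : realType) (n : nat) (N : kahlerData R n).
Variable Phi : 'rV[R]_n -> N -> N.
Hypotheses (mN : is_manifold (katlas N)) (connN : connected [set: N])
  (actPhi : torus_action Phi) (effPhi : effective Phi)
  (sPhi : forall a, smooth_map (katlas N) (katlas N) setT (Phi a)).

Lemma iter_action k a p : iter k (Phi a) p = Phi (k%:R *: a) p.
Proof.
have [P0 PD _ _] := actPhi; elim: k => [|k IH]; first by rewrite scale0r P0.
by rewrite iterS IH -PD -nat1r scalerDl scale1r.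
Qed.

Lemma rational_vector_order (r : 'rV[rat]_n) : exists2 m, (0 < m)%N &
  integral_vector (m%:R *: map_mx ratr r : 'rV[R]_n).
Proof.
pose D i : nat := absz (denq (r 0 i)).
have D0 i : (0 < D i)%N by rewrite absz_gt0 denq_neq0.
exists (\prod_i D i)%N; first exact: prodn_gt0.
move=> i; rewrite !mxE (bigD1 i)//= natrM mulrAC rpredM ?natr_int//.
rewrite -[r 0 i]divq_num_den fmorph_div/= !ratr_int.
have -> : (D i)%:R = (denq (r 0 i))%:~R :> R by rewrite /D pmulrn absz_denq.
by rewrite mulrC divfK ?intr_int// intr_eq0 denq_neq0.
Qed.

Lemma rational_fixed_interior (r : 'rV[rat]_n) :
  ~ integral_vector (map_mx ratr r : 'rV[R]_n) ->
  [set p | Phi (map_mx ratr r) p = p]° = set0.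
Proof.
move=> nir; apply: contrapT => /eqP/set0P ne; apply: nir.
have [m m0 im] := rational_vector_order r.
have cl : closed [set p | Phi (map_mx ratr r) p = p]°.
  apply: (finite_order_fixed_interior_closed mN (sPhi _) m0) => p.
  by rewrite iter_action; have [_ _ ->] := actPhi.
have full : [set p | Phi (map_mx ratr r) p = p]° = setT.
  apply: connN => //; exists [set p | Phi (map_mx ratr r) p = p]°; rewrite ?setTI//.
  exact: open_interior.
apply: effPhi => p.
have : [set p | Phi (map_mx ratr r) p = p]° p by rewrite full.
by move/interior_subset.
Qed.

Lemma stabilizer_closed p : closed [set a | Phi a p = p].
Proof.
have [hN _ _ _ _] := mN; have [_ _ _ sP] := actPhi.
move=> a cla; apply: hN => B C Bp Cp.
have cont : Phi b p @[b --> a] --> Phi a p.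
  have [c _] := sP (a, p) I.
  apply: (@cvg_comp _ _ _ (fun b => (b, p)) (fun ap => Phi ap.1 ap.2) _ (nbhs (a, p))).
    exact: (cvg_pair (@cvg_id _ (nbhs a)) (@cvg_cst _ p _ (nbhs a) _)).
  exact: c.
have [b [/= bp Bb]] := cla _ (cont _ Bp).
exists p; split; last exact: nbhs_singleton.
by move: Bb; rewrite /= bp.
Qed.

(** Baire's theorem is applied in the model vector space of one chart rather than on [N], so each
    set of moved points is transported there and completed to a dense open set. *)
Lemma free_locus_dense : dense (free_locus Phi).
Proof.
have [_ _ exi /(_ _) chi _] := mN.
have [P0 PD PZ _] := actPhi.
move=> O [p Op] oO; have [i ip] := exi p.
have [oi or K ci cp] := chi i.
pose G (r : 'rV[rat]_n) : set N := [set q | Phi (map_mx ratr r) q <> q].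
have oG r : open (G r).
  rewrite (_ : G r = ~` [set q | Phi (map_mx ratr r) q = q])//.
  by apply/closed_openC/(closed_fixed mN) => q; have [] := sPhi (map_mx ratr r) (I : setT q).
(* Rational vectors are enumerated by [pickle]. The exterior of the chart range is added to make the
   set dense in the whole space; codes of no vector or of an integral one give the whole space. *)
pose F (k : nat) : set 'rV[R]_(n + n) :=
  if unpickle k is Some r then
    if pselect (integral_vector (map_mx ratr r : 'rV[R]_n)) then setT else
    [set x | coord_range i x /\ G r (param i x)] `|` ~` closure (coord_range i)
  else setT.
have odF k : open (F k) /\ dense (F k).
  have triv : open [set: 'rV[R]_(n + n)] /\ dense [set: 'rV[R]_(n + n)].
    by split; [exact: openT|move=> D D0 _; rewrite setIT].
  rewrite /F; case: unpickle => [r|]//; case: pselect => // nir; split.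
    apply: openU; first exact: open_param_preimage.
    exact/closed_openC/closed_closure.
  move=> D [y Dy] oD.
  have [[z [Dz rz]]|ndis] := pselect (D `&` coord_range i !=set0); last first.
    exists y; split => //; right => /(_ D (open_nbhs_nbhs (conj oD Dy)))[z [rz Dz]].
    by apply: ndis; exists z.
  have Dpz : nbhs (param i z) [set q | dom i q /\ D (coord i q)].
    apply: (nbhs_chart mN); first exact: param_dom.
    by rewrite coordK//; exact: open_nbhs_nbhs.
  have [q [[iq Dq] nq]] : exists q, (dom i q /\ D (coord i q)) /\ G r q.
    apply: contrapT => noq.
    suff : [set p | Phi (map_mx ratr r) p = p]° (param i z).
      by rewrite rational_fixed_interior.
    apply: filterS Dpz => q Dq; apply: contrapT => nq; apply: noq.
    by exists q.
  exists (coord i q); split => //; left; split; first by exists q.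
  by rewrite K.
have [| |x [[rx Ox] Fx]] := @Baire R 'rV[R]_(n + n) F odF
  [set x | coord_range i x /\ O (param i x)].
- by exists (coord i p); split; [exists p|rewrite K].
- exact: open_param_preimage.
exists (param i x); split => // a ax; apply: contrapT => nia.
(* A non-integral stabilizer element would give a rational one [r]. But [x] lies in the set coded by
   [r], and not in the exterior of the range, so [r] moves [param i x]. *)
have [| |r [Hr nir]] :=
  closed_subgroup_rational (@stabilizer_closed (param i x)) _ _ ax nia.
- move=> b c /= bx cx.
  by rewrite -{1}cx -PD subrK.
- by move=> b ib; exact: PZ.
have := Fx (pickle r) I; rewrite /F pickleK; case: pselect => // _ [[_]|].
  by move=> /(_ Hr).
by apply; exact: subset_closure.
Qed.

End FreeLocus.

(** * Variances in an exponential family *)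

Section ExponentialFamilyVariance.
Variables (R : realType) (n : nat) (Omega : finType) (E : expFamily R n Omega).
Implicit Types (theta v c : 'rV[R]_n) (x : Omega).

Definition statistic v x : R := \sum_k v 0 k * efF E k x.

Definition variance_of (p : {ptws Omega -> R}) (X : Omega -> R) : R :=
  expect p (fun x => (X x - expect p X) ^+ 2).

Lemma statistic_differentiable x theta :
  differentiable (fun t => statistic t x) theta.
Proof.
rewrite (_ : (fun t => statistic t x) =
    \sum_(k < n) (fun t : 'rV[R]_n => t 0 k * efF E k x)); last first.
  by apply/funext => t; rewrite /statistic fct_sumE.
apply: differentiable_sum => k.
by apply: differentiableM => //; exact: differentiable_coord.
Qed.

Lemma derive_statistic x theta v :
  'D_v (fun t => statistic t x) theta = statistic v x.
Proof.
have lin : linear (fun t => statistic t x : R^o).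
  move=> a u w; rewrite /statistic scaler_sumr -big_split/=.
  by apply: eq_bigr => k _; rewrite !mxE mulrDl -mulrA.
pose f : {linear 'rV[R]_n -> R^o} :=
  HB.pack (fun t => statistic t x : R^o) (GRing.isLinear.Build _ _ _ _ _ lin).
have cf : continuous f.
  by move=> t; apply: differentiable_continuous; exact: statistic_differentiable.
rewrite deriveE; last exact: statistic_differentiable.
by rewrite -[fun t => _]/(f : _ -> _) diff_lin.
Qed.

(** Normalization forces [efpsi] to be the logarithm of the partition function, which is where its
    differentiability comes from. *)
Lemma efpsiE theta :
  efpsi E theta = ln (\sum_x expR (efC E x + statistic theta x)).
Proof.
have := efP E theta; rewrite /exp_density.
under eq_bigr do rewrite expRD.
have n0 := lt0r_neq0 (expR_gt0 (efpsi E theta)).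
rewrite -mulr_suml expRN => /(canRL (mulfVK n0)); rewrite mul1r => Z.
by rewrite /statistic Z expRK.
Qed.

Lemma expR_differentiable (y : R) : differentiable expR y.
Proof. by apply/derivable1_diffP; exact: derivable_expR. Qed.

Lemma derive_expR_comp (V : normedModType R) (f : V -> R) (t w : V) :
  differentiable f t -> 'D_w (expR \o f) t = expR (f t) * 'D_w f t.
Proof.
move=> df; rewrite derive_comp//; last exact: expR_differentiable.
rewrite deriveE; last exact: expR_differentiable.
rewrite diff1E; last exact: expR_differentiable.
by rewrite derive1E derive_val -[LHS]/(_ * _) mulrC.
Qed.

Lemma differentiable_fsum (V W : normedModType R) (I : finType) (f : I -> V -> W) t :
  (forall i, differentiable (f i) t) -> differentiable (fun s => \sum_i f i s) t.
Proof.
move=> df; rewrite -fct_sumE.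
by elim/big_ind : _ => // g h dg dh; exact: differentiableD.
Qed.

Lemma derive_fsum (V W : normedModType R) (I : finType) (f : I -> V -> W) (t w : V) :
  (forall i, differentiable (f i) t) ->
  'D_w (fun s => \sum_i f i s) t = \sum_i 'D_w (f i) t.
Proof.
move=> df; rewrite deriveE; last exact: differentiable_fsum.
rewrite -fct_sumE.
suff [_ ->] : differentiable (\sum_i f i) t /\ 'd (\sum_i f i) t w = \sum_i 'd (f i) t w.
  by apply: eq_bigr => i _; rewrite deriveE.
elim/big_ind2 : _ => [|a b a' b' [da Ea] [db Eb]|i _]; last by [].
  by split => //; rewrite (_ : 0 = cst 0)// diff_cst.
by split; [exact: differentiableD|rewrite diffD//= Ea Eb].
Qed.

Lemma efpsi_differentiable theta : differentiable (efpsi E) theta.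
Proof.
have -> : efpsi E = @ln R \o (fun t => \sum_x (expR \o (cst (efC E x) + statistic^~ x)) t).
  by apply/funext => t; rewrite efpsiE.
have dln (y : R) : 0 < y -> differentiable (@ln R) y.
  by move=> y0; apply/derivable1_diffP; exact: (@ex_derive _ _ _ _ _ _ _ (is_derive1_ln y0)).
apply: differentiable_comp.
  apply: differentiable_fsum => x.
  apply: (@differentiable_comp _ _ _ _ (cst (efC E x) + statistic^~ x) expR);
    last exact: expR_differentiable.
  by apply: differentiableD => //; exact: statistic_differentiable.
apply: dln.
rewrite -[ltRHS]/(\sum_x expR (efC E x + statistic theta x)).
have := efP E theta.
(* [Omega] is nonempty because the densities sum to 1, so the argument of the logarithm is
   positive. *)
have [x _|no] := pickP (@predT Omega).
  by move=> _; rewrite (bigD1 x)//= ltr_pwDl ?expR_gt0// sumr_ge0// => y _; exact: expR_ge0.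
by rewrite big_pred0// => /eqP; rewrite eq_sym oner_eq0.
Qed.

Definition log_density x theta : R := efC E x + statistic theta x - efpsi E theta.

Lemma densityE theta x : density E theta x = expR (log_density x theta).
Proof. by []. Qed.

Lemma log_density_differentiable x theta : differentiable (log_density x) theta.
Proof.
apply: differentiableB; last exact: efpsi_differentiable.
by apply: differentiableD => //; exact: statistic_differentiable.
Qed.

Lemma derive_log_density_psi x theta v :
  'D_v (log_density x) theta = statistic v x - 'D_v (efpsi E) theta.
Proof.
have dpsi : derivable (efpsi E) theta v.
  exact/diff_derivable/efpsi_differentiable.
have ds : derivable (statistic^~ x) theta v.
  exact/diff_derivable/statistic_differentiable.
rewrite (_ : log_density x = cst (efC E x) + statistic^~ x - efpsi E)//.
have dC : derivable (cst (efC E x) : 'rV[R]_n -> R) theta v by [].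
rewrite (deriveB (derivableD dC ds) dpsi) (deriveD dC ds) derive_cst add0r.
by rewrite derive_statistic.
Qed.

Lemma density_differentiable x theta : differentiable (fun t => density E t x : R) theta.
Proof.
apply: (@differentiable_comp _ _ _ _ (log_density x) expR).
  exact: log_density_differentiable.
exact: expR_differentiable.
Qed.

Lemma derive_density x theta v : 'D_v (fun t => density E t x : R) theta =
  density E theta x * 'D_v (log_density x) theta.
Proof. exact: derive_expR_comp (log_density_differentiable x theta). Qed.

(** Differentiate the identity stating that the densities sum to 1. *)
Lemma derive_efpsi theta v :
  'D_v (efpsi E) theta = expect (density E theta) (statistic v).
Proof.
have : 'D_v (fun t => \sum_x (density E t x : R)) theta = 0.
  rewrite (_ : (fun _ => _) = cst 1) ?derive_cst//.
  by apply/funext => t; exact: efP.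
rewrite derive_fsum; last by move=> x; exact: density_differentiable.
under eq_bigr do rewrite derive_density derive_log_density_psi mulrBr.
rewrite sumrB -mulr_suml (efP E theta) mul1r => /subr0_eq <-.
by apply: eq_bigr => x _; rewrite mulrC.
Qed.

Lemma expect_affine theta (c0 : R) (X : Omega -> R) :
  expect (density E theta) (fun x => c0 + X x) = c0 + expect (density E theta) X.
Proof.
rewrite /expect; under eq_bigr do rewrite mulrDl.
by rewrite big_split/= -mulr_sumr (efP E theta) mulr1.
Qed.

Lemma derive_log_density x theta v (c0 : R) (X : Omega -> R) :
  (forall y, X y = c0 + statistic v y) ->
  'D_v (log_density x) theta = X x - expect (density E theta) X.
Proof.
move=> XE; rewrite derive_log_density_psi derive_efpsi.
have -> : X = fun y => c0 + statistic v y by apply/funext.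
by rewrite expect_affine opprD addrACA subrr add0r.
Qed.

Lemma expect_differentiable theta (X : Omega -> R) :
  differentiable (fun t => expect (density E t) X) theta.
Proof.
apply: differentiable_fsum => x.
by apply: differentiableM => //; exact: density_differentiable.
Qed.

(** The derivative is the covariance of [X] with the score along [v], and by [derive_log_density]
    that score is [X] centred. *)
Lemma derive_expect theta v (c0 : R) (X : Omega -> R) :
  (forall x, X x = c0 + statistic v x) ->
  'D_v (fun t => expect (density E t) X) theta = variance_of (density E theta) X.
Proof.
move=> XE; rewrite derive_fsum; last first.
  by move=> x; apply: differentiableM => //; exact: density_differentiable.
set p := density E theta; pose m := expect p X.
have -> : variance_of p X = \sum_x X x * (p x * (X x - m)) - m * \sum_x (X x * p x - m * p x).
  rewrite mulr_sumr -sumrB; apply: eq_bigr => x _; rewrite -/m; ring.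
rewrite sumrB -mulr_sumr (efP E theta) mulr1 -/(expect p X) subrr mulr0 subr0.
apply: eq_bigr => x _.
rewrite -(derive_log_density x theta XE) -derive_density.
by rewrite deriveMl//; apply: diff_derivable; exact: density_differentiable.
Qed.

(** The Fisher quadratic form at [v] is the second moment of the score along [v], which is again [X]
    centred. *)
Lemma inner_fisher theta v (c0 : R) (X : Omega -> R) :
  (forall x, X x = c0 + statistic v x) ->
  inner (fisher E theta) v v = variance_of (density E theta) X.
Proof.
move=> XE; rewrite /inner mxE.
have lnE x : (fun t => ln (density E t x)) = log_density x.
  by apply/funext => t; rewrite densityE expRK.
have Dv x : X x - expect (density E theta) X =
    \sum_k v 0 k * 'D_(delta_mx 0 k) (log_density x) theta.
  rewrite -(derive_log_density x theta XE) derive_coordE//.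
  exact: log_density_differentiable.
rewrite /variance_of {1}/expect.
under [RHS]eq_bigr do rewrite Dv expr2 mulr_suml mulr_suml.
rewrite exchange_big/=; apply: eq_bigr => j _.
rewrite !mxE mulr_suml.
under [LHS]eq_bigr do rewrite mxE /expect mulr_sumr mulr_suml.
rewrite exchange_big/=; apply: eq_bigr => x _.
rewrite mulr_sumr mulr_suml; apply: eq_bigr => i _.
rewrite !lnE; ring.
Qed.

End ExponentialFamilyVariance.

(** * Metrics near a point, and the quotient of the tangent bundle *)

Section PositiveForms.
Variable R : realType.

Lemma innerE d (A : 'M[R]_d) u v :
  inner A u v = \sum_j \sum_i u 0 i * A i j * v 0 j.
Proof.
rewrite /inner mxE; apply: eq_bigr => j _; rewrite !mxE mulr_suml.
by apply: eq_bigr.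
Qed.

Lemma innerZ d (A : 'M[R]_d) (a : R) u :
  inner A (a *: u) (a *: u) = a ^+ 2 * inner A u u.
Proof.
by rewrite /inner linearZ/= -!scalemxAl -scalemxAr !mxE mulrA expr2.
Qed.

Lemma inner_diff_le d (A B : 'M[R]_d) v :
  `|inner A v v - inner B v v| <= d%:R ^+ 2 * `|A - B| * `|v| ^+ 2.
Proof.
rewrite !innerE -sumrB.
apply: (@le_trans _ _ (\sum_(j < d) \sum_(i < d) `|A - B| * `|v| ^+ 2)); last first.
  by rewrite !sumr_const !card_ord -mulrnA -[leLHS]mulr_natl natrM -expr2 mulrA.
apply: le_trans (ler_norm_sum _ _ _) _; apply: ler_sum => j _.
rewrite -sumrB; apply: le_trans (ler_norm_sum _ _ _) _; apply: ler_sum => i _.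
rewrite -mulrBl -mulrBr !normrM mulrAC mulrC expr2.
apply: ler_pM => //; first by have := ler_mx_entry (A - B) i j; rewrite !mxE.
by apply: ler_pM => //; exact: ler_mx_entry.
Qed.

(** The form at [x0] has a positive minimum [mu] on the compact unit sphere, and a perturbation of
    the matrix costs at most half of it. The sphere is empty when [d = 0], whence the case
    distinction. *)
Lemma posdef_near d (A : 'rV[R]_d -> 'M[R]_d) x0 :
  {for x0, continuous A} -> (forall v, v != 0 -> 0 < inner (A x0) v v) ->
  exists2 l : R, 0 < l &
    \forall x \near x0, forall v, l * `|v| ^+ 2 <= inner (A x) v v.
Proof.
move=> cA pos.
have [mu mu0 muP] : exists2 mu : R, 0 < mu &
    forall v, mu * `|v| ^+ 2 <= inner (A x0) v v.
  pose S := [set x : 'rV[R]_d | `|x| = 1].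
  have nrm v : v != 0 -> S (`|v|^-1 *: v).
    by move=> v0; rewrite /S/= normrZ normfV normr_id mulVf// normr_eq0.
  have [S0|S0] := pselect (S !=set0); last first.
    exists 1 => // v; have [->|/nrm Sv] := eqVneq v 0; last first.
      by exfalso; apply: S0; exists (`|v|^-1 *: v).
    by rewrite normr0 expr0n mulr0 /inner mul0mx mul0mx mxE.
  have cS : compact S.
    apply: bounded_closed_compact.
      by exists 1; split => // M M1 x /= ->; exact: ltW.
    apply: (@preimage_closed _ _ (fun x : 'rV[R]_d => `|x|) [set 1 : R]).
      by move=> x _; exact: norm_continuous.
    exact: closed_eq.
  have cf : continuous (fun v : 'rV[R]_d => inner (A x0) v v).
    rewrite (_ : (fun v => _) = fun v : 'rV[R]_d =>
      \sum_j \sum_i v 0 i * A x0 i j * v 0 j); last first.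
      by apply/funext => v; rewrite innerE.
    move=> x; apply: (@cvg_sumr _ _ (nbhs x)) => j.
    apply: (@cvg_sumr _ _ (nbhs x)) => i.
    apply: cvgM; first apply: cvgMr_tmp.
      exact: (@cvg_mx_entry _ _ (nbhs x) _ _ _ id x 0 i cvg_id).
    exact: (@cvg_mx_entry _ _ (nbhs x) _ _ _ id x 0 j cvg_id).
  have [c /set_mem Sc cmin] := EVT_min_rV S0 cS (continuous_subspaceT cf).
  exists (inner (A x0) c c).
    by apply: pos; rewrite -normr_eq0 Sc oner_eq0.
  move=> v; have [->|v0] := eqVneq v 0.
    by rewrite normr0 expr0n mulr0 /inner mul0mx mul0mx mxE.
  have := cmin _ (mem_set (nrm v v0)); rewrite innerZ.
  by rewrite exprVn ler_pdivlMl ?exprn_gt0 ?normr_gt0// mulrC.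
exists (mu / 2); first by rewrite divr_gt0.
have e0 : 0 < mu / 2 / (d%:R ^+ 2 + 1).
  by rewrite !divr_gt0// ltr_wpDl// exprn_ge0.
have /cvgrPdist_le/(_ _ e0) := cA.
apply: filterS => x xle v.
have h : d%:R ^+ 2 * `|A x - A x0| <= mu / 2.
  rewrite distrC in xle; apply: (@le_trans _ _ ((d%:R ^+ 2 + 1) * (mu / 2 / (d%:R ^+ 2 + 1)))).
    by apply: ler_pM => //; rewrite ?exprn_ge0// lerDl.
  by rewrite mulrC divfK// gt_eqF// ltr_wpDl// exprn_ge0.
have := inner_diff_le (A x) (A x0) v; rewrite ler_norml => /andP[hl _].
have := muP v; have := sqr_ge0 `|v|; nra.
Qed.

Lemma C1_critical_near d (f : 'rV[R]_d -> R) x0 (e : R) :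
  C1_at x0 f -> (forall v, 'D_v f x0 = 0) -> 0 < e ->
  \forall x \near x0, forall v, `|'D_v f x| <= e * `|v|.
Proof.
move=> [df cDf] D0 e0.
have ed0 : 0 < e / d.+1%:R by rewrite divr_gt0.
have Dk : \forall x \near x0, forall k : 'I_d, `|'D_(delta_mx 0 k) f x| <= e / d.+1%:R.
  near=> x; near: x; apply: filter_forall => k.
  have /cvgrPdist_le/(_ _ ed0) := cDf (delta_mx 0 k); rewrite D0.
  by apply: filterS => x; rewrite sub0r normrN.
near=> x => v.
have dfx : differentiable f x by near: x.
have Dkx : forall k : 'I_d, `|'D_(delta_mx 0 k) f x| <= e / d.+1%:R by near: x.
rewrite (derive_coordE _ dfx); apply: le_trans (ler_norm_sum _ _ _) _.
apply: (@le_trans _ _ (\sum_(k < d) `|v| * (e / d.+1%:R))).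
  apply: ler_sum => k _; rewrite normrZ; apply: ler_pM => //.
  exact: ler_mx_entry.
rewrite sumr_const card_ord -[leLHS]mulr_natr.
rewrite -mulrA mulrC ler_wpM2r// -[leRHS]mulr1 -mulrA ler_wpM2l ?(ltW e0)//.
by rewrite ler_pdivrMl// mulr1 ler_nat leqnSn.
Unshelve. all: by end_near. Qed.

End PositiveForms.

(** * The quotient of the tangent bundle by a parallel lattice *)

Section Quotient.
Variables (R : realType) (n : nat).
Local Open Scope quotient_scope.

Lemma qL_lattice (Y : 'rV[R]_n -> 'M[R]_n) u u' : qL Y u = qL Y u' ->
  exists2 k : 'rV[R]_n, integral_vector k & u' = tshift Y k u.
Proof. by move=> /eqquotP/asboolP. Qed.

Lemma piL_qL (Y : 'rV[R]_n -> 'M[R]_n) u : piL (qL Y u) = lsubmx u.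
Proof.
have [k _ e] := @qL_lattice Y u (repr (qL Y u : {eq_quot lattice_equiv Y})) (esym (reprK _)).
by rewrite /piL e tshift_base.
Qed.

Lemma qL_continuous (Y : 'rV[R]_n -> 'M[R]_n) : continuous (qL Y).
Proof. exact: pi_continuous. Qed.

Lemma parallel_frame_cst (Y : 'rV[R]_n -> 'M[R]_n) theta :
  parallel_frame Y -> Y theta = Y 0.
Proof.
move=> pY; apply/matrixP => i j.
pose h (s : R) : R := Y (s *: theta) i j.
suff : h 1 = h 0 by rewrite /h scale1r scale0r.
apply: is_derive_0_is_cst => s.
have [_ dY DY] := pY (s *: theta).
have dl : differentiable (fun s : R => s *: theta) s by [].
have dYij : differentiable (fun z => Y z i j) (s *: theta).
  apply: (@differentiable_comp _ _ _ _ Y (fun M : 'M[R]_n => M i j)) => //.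
  exact: differentiable_coord.
have dh : differentiable h s.
  exact: (@differentiable_comp _ _ _ _ (fun s : R => s *: theta) (fun z => Y z i j)).
split; first exact: diff_derivable.
rewrite [LHS](@derive_comp R R _ _ (fun s : R => s *: theta) (fun z => Y z i j))//.
move: ('D_1 _ s) => w.
have := DY w; rewrite derive_mx; last exact: diff_derivable.
by move=> /matrixP/(_ i j); rewrite !mxE.
Qed.

(** The frame is constant, so the lattice vector [k] separating two equivalent points is a
    continuous linear function of their difference. On a small ball [k] has norm less than 1 and,
    being integral, vanishes. *)
Lemma qL_locally_injective (Y : 'rV[R]_n -> 'M[R]_n) u : parallel_frame Y ->
  exists2 U, open U /\ set_inj U (qL Y) & U u.
Proof.
move=> pY; have [Yu _ _] := pY 0.
have cont : rsubmx x *m invmx (Y 0) @[x --> (0 : 'rV[R]_(n + n))] --> (0 : 'rV[R]_n).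
  have cr : (rsubmx x : 'rV[R]_n) @[x --> (0 : 'rV[R]_(n + n))] --> (0 : 'rV[R]_n).
    have r0 : rsubmx (0 : 'rV[R]_(n + n)) = 0 :> 'rV[R]_n by rewrite linear0.
    rewrite -[X in _ --> X]r0.
    exact: (differentiable_continuous (@differentiable_rsubmx R 1 n n 0)).
  have := cvg_comp _ _ cr (@mulmxr_continuous R n n (invmx (Y 0)) 0).
  by rewrite mul0mx.
have /cvgrPdist_lt/(_ _ ltr01)/nbhs_normP[d /= d0 dP] := cont.
have d20 : 0 < d / 2 by rewrite divr_gt0.
exists (ball u (d / 2)); last exact: ballxx.
split; first exact: ball_open.
move=> u1 u2 /set_mem + /set_mem + /qL_lattice[k ik u2E].
rewrite -ball_normE/= => h1 h2.
have : `|k| < 1.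
  have -> : k = rsubmx (u2 - u1) *m invmx (Y 0).
    rewrite u2E /tshift addrC addKr row_mxKr (parallel_frame_cst _ pY).
    by rewrite mulmxK.
  have := dP (u2 - u1); rewrite /ball_/= !sub0r !normrN; apply.
  rewrite -(subrKA u); apply: le_lt_trans (ler_normD _ _) _.
  by rewrite distrC; lra.
move=> k1; suff k0 : k = 0 by rewrite u2E k0 tshift0.
apply/rowP => i; rewrite mxE.
have := ler_mx_entry k 0 i; have /intrP[z zE] := ik i.
rewrite zE => /le_lt_trans/(_ k1); rewrite -intr_norm -[1]/(1%:~R) ltr_int => z1.
by have -> : z = 0 by lia.
Qed.

End Quotient.

(** * The gradient of an expectation *)

Lemma dense_near (T : topologicalType) (S : set T) (q : T) (P : set T) :
  dense S -> nbhs q P -> exists2 q', S q' & P q'.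
Proof.
move=> dS; rewrite nbhsE => -[B [oB Bq] BP].
have [q' [Bq' Sq']] := dS B (ex_intro _ q Bq) oB.
by exists q' => //; exact: BP.
Qed.

Section Variance.
Variables (R : realType) (Omega : finType).

Lemma expect_cvg (T : Type) (F : set_system T) (FF : Filter F)
    (K : T -> {ptws Omega -> R}) (p : {ptws Omega -> R})
    (X : T -> Omega -> R) (Xl : Omega -> R) :
  (forall x, X t x @[t --> F] --> Xl x) ->
  (forall x, (K t x : R) @[t --> F] --> (p x : R)) ->
  expect (K t) (X t) @[t --> F] --> expect p Xl.
Proof.
by move=> XF KF; apply: cvg_sumr => x; exact: cvgM (XF x) (KF x).
Qed.

Lemma variance_of_continuous (M : topologicalType) (K : M -> {ptws Omega -> R})
    (X : Omega -> R) :
  continuous K -> continuous (fun q => variance_of (K q) X).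
Proof.
move=> cK q.
have Kx x : (K t x : R) @[t --> q] --> (K q x : R).
  exact: (cvg_comp _ _ (cK q) (@proj_continuous _ _ x (K q))).
apply: (@expect_cvg _ (nbhs q)) => // x.
have h y : X y - expect (K t) X @[t --> q] --> X y - expect (K q) X.
  apply: (@cvgB _ _ _ (nbhs q)); first exact: cvg_cst.
  by apply: (@expect_cvg _ (nbhs q)) => // z; exact: cvg_cst.
exact: (cvgM (h x) (h x)).
Qed.

Lemma variance_of_ge0 (p : {ptws Omega -> R}) (X : Omega -> R) :
  (forall x, 0 <= p x) -> 0 <= variance_of p X.
Proof. by move=> p0; apply: sumr_ge0 => x _; rewrite mulr_ge0// sqr_ge0. Qed.

(** [X] equals its mean wherever [p] is nonzero, and there is such a point because [p] sums to 1. *)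
Lemma variance_of_eq0 (p : {ptws Omega -> R}) (X : Omega -> R) :
  prob_functions p -> variance_of p X = 0 -> range X (expect p X).
Proof.
move=> [p0 p1] /eqP; rewrite psumr_eq0; last first.
  by move=> x _; rewrite mulr_ge0// sqr_ge0.
move=> /allP v0.
have [x px] : exists x, p x != 0.
  apply: contrapT => /forallNP no; move: p1; rewrite big1; last first.
    by move=> x _; apply/eqP/negPn/negP; exact: no.
  by move/eqP; rewrite eq_sym oner_eq0.
exists x => //; have := v0 x (mem_index_enum x).
by rewrite /= mulf_eq0 (negPf px) orbF sqrf_eq0 subr_eq0 => /eqP.
Qed.

End Variance.

(** * Gradient and variance on a torification *)

Section Torification.
Variables (R : realType) (n : nat) (Omega : finType) (E : expFamily R n Omega).
Variables (N : kahlerData R n) (Phi : 'rV[R]_n -> N -> N).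
Hypothesis mN : is_manifold (katlas N).
Variables (Y : 'rV[R]_n -> 'M[R]_n) (G : EL_kahler E Y -> N).
Hypothesis torG : torification_data Phi G.

(** With a chart whose coordinate at the class of [u] is [u] itself, [G] can be studied as a
    function on the tangent bundle. *)
Lemma EL_chart u : exists i : chart (katlas (EL_kahler E Y)),
  dom i (qL Y u : EL_kahler E Y) /\ coord i (qL Y u : EL_kahler E Y) = u.
Proof.
have [pY _ _ _ _] := torG; have [U oU Uu] := qL_locally_injective u pY.
exists (exist _ U oU); split; first by exists u.
rewrite /=; apply: xget_unique => // y [Uy /=].
by apply: oU.2; rewrite inE.
Qed.

Lemma torification_chart u (j : chart (katlas N)) : dom j (G (qL Y u)) ->
  C1_at u (fun u => coord j (G (qL Y u))) /\
  forall w, let v := 'D_w (fun u => coord j (G (qL Y u))) u in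
    inner (kmetric j (coord j (G (qL Y u)))) v v =
    inner (block_mx (fisher E (lsubmx u)) 0 0 (fisher E (lsubmx u))) w w.
Proof.
move=> ju; have [_ [[sG _] iG] _ _ _] := torG.
have [i [iu ci]] := EL_chart u.
have C1 : C1_at u (fun u => coord j (G (qL Y u))).
  have [_ /(_ i j iu ju)/smooth_at_C1] := sG (qL Y u) I.
  by rewrite ci.
split => // w /=.
rewrite deriveE; last exact: C1_at_differentiable.
by have := iG i j (qL Y u) I iu ju w w; rewrite /tangent_map ci.
Qed.

Variables (K : N -> {ptws Omega -> R}) (X : Omega -> R) (c0 : R) (c : 'rV[R]_n).
Hypothesis KG : forall u, K (G (qL Y u)) = density E (lsubmx u).
Hypothesis XE : forall x, X x = c0 + statistic E c x.

(* The vector v is the image of the real direction c of the tangent bundle; it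
   is the gradient of the expectation of X. *)
Lemma expectation_gradient u (j : chart (katlas N)) (f : 'rV[R]_(n + n) -> R) :
  let q := G (qL Y u) in let y := coord j q in
  dom j q -> differentiable f y ->
  (\forall z \near y, f z = expect (K (param j z)) X) ->
  exists v, 'D_v f y = variance_of (K q) X /\
    inner (kmetric j y) v v = variance_of (K q) X.
Proof.
move=> q y jq df fK; have [C1 met] := torification_chart jq.
pose w : 'rV[R]_(n + n) := row_mx c 0.
pose psi := fun u => coord j (G (qL Y u)).
exists ('D_w psi u); split; last first.
  rewrite met KG -(inner_fisher (lsubmx u) XE) /inner /w.
  rewrite mul_row_block tr_row_mx mul_row_col !mul0mx !mulmx0 !addr0.
  by rewrite linear0 mulmx0 addr0.
rewrite -[LHS](derive_comp w (C1_at_differentiable C1) df).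
have cG : G (qL Y u') @[u' --> u] --> q.
  have [_ [[sG _] _] _ _ _] := torG.
  by apply: (cvg_comp _ _ (@qL_continuous _ _ Y u)); have [] := sG (qL Y u) I.
have [_ _ _ /(_ j)[oj _ _ _ _] _] := mN.
(* Pulled back to the tangent bundle, [f] depends on the base point only, so its derivative along
   [w] is the derivative of the expectation along [c]. *)
have nE : \forall u' \near u, (f \o psi) u' = expect (density E (lsubmx u')) X.
  near=> u'.
  have ju' : dom j (G (qL Y u')).
    by near: u'; exact: (cG _ (open_nbhs_nbhs (conj oj jq))).
  rewrite /= -KG -[in RHS](paramK mN ju').
  by near: u'; exact: (C1_at_continuous C1 fK).
rewrite (near_eq_derive w nE).
have dl : differentiable (fun z : 'rV[R]_(n + n) => lsubmx z : 'rV[R]_n) u.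
  exact: differentiable_lsubmx.
rewrite [LHS](@derive_comp R _ _ _ (fun z : 'rV[R]_(n + n) => lsubmx z : 'rV[R]_n)
  (fun t => expect (density E t) X) u w dl); last exact: expect_differentiable.
have -> : 'D_w (fun z : 'rV[R]_(n + n) => lsubmx z : 'rV[R]_n) u = c.
  rewrite deriveE// -[fun z => _]/(@lsubmx R 1 n n : _ -> _) diff_lin.
    by rewrite /w /= row_mxKl.
  by move=> z; apply: differentiable_continuous; exact: differentiable_lsubmx.
by rewrite KG; exact: derive_expect XE.
Unshelve. all: by end_near. Qed.

Hypothesis cK : continuous K.
Hypothesis K_ge0 : forall q x, 0 <= K q x.
Hypothesis dense_free : dense (free_locus Phi).
Hypothesis metN : is_riemannian N.

(** If the variance [V] at [q] were positive, a nearby free point would have a variance [nu > V / 2]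
    and a gradient [v] with [nu = df(v) = g(v, v)]. Near the critical point [df] is small while [g]
    stays bounded below, which bounds [nu] too tightly. *)
Lemma critical_variance0 (q : N) (j : chart (katlas N)) (f : 'rV[R]_(n + n) -> R) :
  dom j q -> C1_at (coord j q) f -> (forall v, 'D_v f (coord j q) = 0) ->
  (\forall z \near coord j q, f z = expect (K (param j z)) X) ->
  variance_of (K q) X = 0.
Proof.
move=> jq C1 D0 fK; apply/eqP; rewrite eq_le variance_of_ge0// andbT leNgt.
apply/negP => V0; set V := variance_of (K q) X in V0.
have [/(_ j)[sj pj] _] := metN.
have rq : coord_range j (coord j q) by exists q.
have [l l0 lP] := posdef_near (sj 0%N _ rq) (pj _ rq).2.
(* The estimates below yield [l * nu <= e ^+ 2]; as [e <= 1], the square is at most [l * V / 4],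
   against [nu > V / 2]. *)
pose e := Num.min 1 (l * V / 4).
have e0 : 0 < e by rewrite lt_min ltr01 divr_gt0 ?mulr_gt0.
have e1 : e <= 1 by rewrite ge_min lexx.
have e2 : e <= l * V / 4 by rewrite ge_min lexx orbT.
have near1 : \forall q' \near q, dom j q' /\ [/\ differentiable f (coord j q'),
    \forall z \near coord j q', f z = expect (K (param j z)) X,
    forall v, l * `|v| ^+ 2 <= inner (kmetric j (coord j q')) v v
  & forall v, `|'D_v f (coord j q')| <= e * `|v|].
  apply: (nbhs_chart mN jq (B := [set y | [/\ differentiable f y,
    \forall z \near y, f z = expect (K (param j z)) X,
    forall v, l * `|v| ^+ 2 <= inner (kmetric j y) v v
  & forall v, `|'D_v f y| <= e * `|v|]])).
  near=> y; split; near: y => //.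
  - exact: C1.1.
  - exact: near_join fK.
  - exact: C1_critical_near.
have near2 : \forall q' \near q, V / 2 < variance_of (K q') X.
  apply: (cvgr_gt _ (@variance_of_continuous _ _ _ _ X cK q)).
  by rewrite ltr_pdivrMr// ltr_pMr// ltr1n.
have [q' free [[jq' [dfq fKq met Df]] Vq']] :=
  dense_near dense_free (filterI near1 near2).
have [_ _ rG _ _] := torG.
have [u uq'] : exists u, G (qL Y u) = q'.
  have : range G q' by rewrite rG.
  move=> [z _ <-]; exists (repr (z : {eq_quot lattice_equiv Y})%qT).
  by rewrite /qL reprK.
rewrite -uq' in jq' dfq fKq.
have [v [Dv gv]] := expectation_gradient jq' dfq fKq.
have := Df v; have := met v; rewrite -uq' Dv gv in Vq' *.
set nu := variance_of _ _ in Vq' *; set nv := `|v|.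
have nv0 : 0 <= nv by exact: normr_ge0.
have nu0 : 0 < nu by lra.
rewrite (gtr0_norm nu0) => h1 h2.
(* Combine [nu <= e * nv] with [l * nv ^+ 2 <= nu] to eliminate the norm [nv] of the gradient. *)
have h3 : nu ^+ 2 <= e ^+ 2 * nv ^+ 2.
  by rewrite -exprMn !(expr2 nu) (expr2 (e * nv)) ler_pM// ltW.
have h4 : l * nu ^+ 2 <= e ^+ 2 * nu.
  have := ltW l0; have := sqr_ge0 e; nra.
have h5 : l * nu <= e ^+ 2 by rewrite -(ler_pM2r nu0) -mulrA -expr2.
nra.
Unshelve. all: by end_near. Qed.

End Torification.

(** * Critical values of an arbitrary Kähler function *)

Theorem proposition7p4 (R : realType) (n : nat) (Omega : finType)
    (E : expFamily R n Omega)
    (N : kahlerData R n) (Phi : 'rV[R]_n -> N -> N) (J : N -> 'rV[R]_n)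
    (toricN : is_kahler_toric Phi J)
    (torN : torification E Phi)
    (regN : regular N)
    (F_inj : injective (estimator E))
    (f : N -> R) (kahlerf : kahler_function f)
    (spec_f : set R) (spec_fP : is_spectrum E Phi f spec_f) :
  critical_values f `<=` spec_f.
Proof.
case: toricN => -[connN _] [[mN _] metN _] [actPhi effPhi] autPhi _.
have [K [phi [X [natK phiA [c0 [c XE]] fE ->]]]] := spec_fP.
move=> _ [p <- crit_p].
have dense_free : dense (free_locus Phi).
  by apply: (free_locus_dense mN connN actPhi effPhi) => a; have [[]] := autPhi a.
have [kappa [Y [G [torG kapG]]] [cK clK Kkappa]] := natK.
have [_ _ [h [phiK hK] [sh _]]] : holomorphic_isometry phi.
  exact: (connected_component_sub phiA).
have KG u : K (G (qL Y u)) = density E (lsubmx u).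
  have [_ _ rG _ _] := torG.
  by rewrite Kkappa -?rG ?kapG ?piL_qL//; exists (qL Y u).
have XE' x : X x = c0 + statistic E (\row_k c k) x.
  by rewrite XE; congr (_ + _); apply: eq_bigr => k _; rewrite mxE.
pose q := phi p.
have [_ _ exi chi _] := mN; have [i ip] := exi p; have [j jq] := exi q.
have ihq : dom i (h q) by rewrite phiK.
have [chq /(_ j i jq ihq)/smooth_at_C1 C1y] := sh q I.
(* The map [y] is the local form of the inverse [h] of [phi]. Composing [f] with [h] gives the
   expectation of [X] under [K], which is critical at [q = phi p]. *)
set y := coord i \o h \o param j in C1y.
have yq : y (coord j q) = coord i p by rewrite /y/= (paramK mN jq) phiK.
have [sf _] := kahlerf.
have C1f : C1_at (y (coord j q)) (f \o param i).
  by rewrite yq; have [_ /(_ i tt ip I)/smooth_at_C1] := sf p I.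
have C1F := C1_at_comp C1y C1f.
rewrite fE; apply: variance_of_eq0; first by have [] := clK q.
apply: (critical_variance0 mN torG KG XE' cK _ dense_free metN jq C1F).
- by move=> q' x; have [_ []] := clK q'.
- move=> v; have dy := C1_at_differentiable C1y.
  have df := C1_at_differentiable C1f.
  by rewrite (derive_comp v dy df) (deriveE _ df) yq; exact: crit_p.
have [_ _ _ _ cpj] := chi j.
have [oi _ _ _ _] := chi i.
have rq : coord_range j (coord j q) by exists q.
have chp : h (param j z) @[z --> coord j q] --> h q.
  apply: (cvg_comp _ _ (cpj _ rq)); rewrite (paramK mN jq).
  exact: chq.
near=> z.
have iz : dom i (h (param j z)).
  by near: z; exact: (chp _ (open_nbhs_nbhs (conj oi ihq))).
by rewrite /y/= (paramK mN iz) fE hK.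
Unshelve. all: by end_near. Qed.
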